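(* Let $M=[m_0,\dots,m_n]$ be a real $d\times(n+1)$ matrix whose columns form a direction set and such that the first non-zero component of each column $m_j$ is positive. Let $\mathbf z=(z_0,\dots,z_n)\in\mathbb C^{n+1}$ with $\operatorname{Re}(z_j)>-1$ for all $j\in\{0,\dots,n\}$. Then the complex box spline $\mathcal B_{\mathbf z}(\cdot|M)$ satisfies $$\langle \mathcal B_{\mathbf z}(\cdot|M),\varphi\rangle=\Big\langle \prod_{j=0}^n\nabla_{m_j}^{z_j+1}\,\mathcal T_{\mathbf z}(\cdot|M),\varphi\Big\rangle\qquad\text{for all }\varphi\in\mathcal S(\mathbb R^d),$$ where $$\Big\langle\prod_{j=0}^n\nabla_{m_j}^{z_j+1}\mathcal T_{\mathbf z}(\cdot|M),\varphi\Big\rangle:=\Big\langle\prod_{j=0}^n\sum_{k\ge 0}(-1)^k\binom{z_j+1}{k}\tau_{km_j}\mathcal T_{\mathbf z}(\cdot|M),\varphi\Big\rangle .$$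
   Context: $\mathcal S(\mathbb R^d)$ is the Schwartz space. The columns of a real $d\times(n+1)$ matrix $M=[m_0,\dots,m_n]$ form a direction set if all $m_j\in\mathbb R^d\setminus\{0\}$ and the columns span $\mathbb R^d$. $\mathbb R_+=[0,\infty)$. For $z\in\mathbb C$ and $t\in\mathbb R$, $t_+^z=e^{z\log t}$ if $t>0$ and $t_+^z=0$ otherwise. For $\operatorname{Re}(z)>-1$ the truncated complex power is $k_z(t)=t_+^z/\Gamma(z+1)$, and $k_{\mathbf z}(t)=\prod_{j=0}^n k_{z_j}(t_j)$ for $t=(t_0,\dots,t_n)\in\mathbb R^{n+1}$. The multivariate truncated complex power is the tempered distribution $$\langle\mathcal T_{\mathbf z}(\cdot|M),\varphi\rangle=\int_{\mathbb R_+^{n+1}}k_{\mathbf z}(t)\varphi(Mt)\,dt,\qquad \varphi\in\mathcal S(\mathbb R^d).$$ Generalized binomial coefficients: $\binom{z+1}{k}=\frac{\Gamma(z+2)}{\Gamma(k+1)\Gamma(z+2-k)}$. The complex B-spline of degree $z$, $\operatorname{Re}(z)>-1$, is $B_z=\nabla^{z+1}k_z$, i.e. $B_z(t)=\sum_{k\ge0}(-1)^k\binom{z+1}{k}k_z(t-k)$. Put $B_{\mathbf z}(t)=\prod_{j=0}^nB_{z_j}(t_j)$. The complex box spline is the tempered distribution $$\langle\mathcal B_{\mathbf z}(\cdot|M),\varphi\rangle=\int_{\mathbb R_+^{n+1}}B_{\mathbf z}(t)\varphi(Mt)\,dt,\qquad\varphi\in\mathcal S(\mathbb R^d).$$ Translation: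 $\langle\tau_vT,\varphi\rangle=\langle T,\varphi(\cdot+v)\rangle$ for $v\in\mathbb R^d$. The operator $\nabla_{m}^{a}=\sum_{k\ge0}(-1)^k\binom{a}{k}\tau_{km}$ is the complex backward difference operator in direction $m$; the product over $j$ denotes composition of these operators. *)

(* Defs.v *)
From HB Require Import structures.
From mathcomp Require Import all_boot all_order all_algebra.
From mathcomp Require Import complex.
From mathcomp Require Import all_classical all_reals all_analysis.

Set Implicit Arguments.
Unset Strict Implicit.
Unset Printing Implicit Defensive.

Import Order.TTheory GRing.Theory Num.Theory.
Import numFieldNormedType.Exports.

Local Open Scope classical_set_scope.
Local Open Scope ring_scope.

(* R^n is represented by n.-tuple R with the product sigma-algebra of the
   library, where R carries its Borel sigma-algebra. *)
Section lebesgue_tuple.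
Context {R : realType}.
Local Notation mR := (measurableTypeR R).

Definition tuple_cons n (p : mR * n.-tuple mR) : n.+1.-tuple mR :=
  [tuple of p.1 :: p.2].

Lemma measurable_tuple_cons n : measurable_fun [set: _] (@tuple_cons n).
Proof. exact: measurable_cons. Qed.

Definition tuple_uncons n (t : n.+1.-tuple mR) : mR * n.-tuple mR :=
  (thead t, [tuple of behead t]).

Lemma measurable_tuple_uncons n : measurable_fun [set: _] (@tuple_uncons n).
Proof.
by apply: measurable_fun_pair; [exact: measurable_tnth|exact: measurable_behead].
Qed.

Lemma tuple_consK n : cancel (@tuple_cons n) (@tuple_uncons n).
Proof.
by case=> x t; rewrite /tuple_uncons /tuple_cons theadE; congr (_, _); exact: val_inj.
Qed.

Definition lebesgue_tuple_step n
    (mu : {sigma_finite_measure set (n.-tuple mR) -> \bar R}) :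
    set (n.+1.-tuple mR) -> \bar R :=
  pushforward (@lebesgue_measure R \x mu)%E (@tuple_cons n).

Section step.
Variables (n : nat) (mu : {sigma_finite_measure set (n.-tuple mR) -> \bar R}).

Let step0 : lebesgue_tuple_step mu set0 = 0%E.
Proof. by rewrite /lebesgue_tuple_step /pushforward preimage_set0 measure0. Qed.

Let step_ge0 A : (0 <= lebesgue_tuple_step mu A)%E.
Proof. exact: (measure_ge0 (@lebesgue_measure R \x mu)%E). Qed.

Let mcons (A : set (n.+1.-tuple mR)) : measurable A ->
  measurable (@tuple_cons n @^-1` A).
Proof.
by move=> mA; rewrite -[X in measurable X]setTI; exact: measurable_tuple_cons.
Qed.

Let step_sigma_additive : semi_sigma_additive (lebesgue_tuple_step mu).
Proof.
move=> F mF tF mUF; rewrite /lebesgue_tuple_step /pushforward preimage_bigcup.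
apply: measure_semi_sigma_additive.
- by move=> i; exact: mcons.
- apply/trivIsetP => /= i j _ _ ij; rewrite -preimage_setI.
  by move/trivIsetP : tF => /(_ _ _ _ _ ij) ->//; rewrite preimage_set0.
- by rewrite -preimage_bigcup; exact: mcons.
Qed.

HB.instance Definition _ := isMeasure.Build _ _ _ (lebesgue_tuple_step mu)
  step0 step_ge0 step_sigma_additive.

Let step_sigma_finite : sigma_finite setT (lebesgue_tuple_step mu).
Proof.
have /sigma_finiteP[F [TF ndF Foo]] := sigma_finiteT (@lebesgue_measure R).
have /sigma_finiteP[G [TG ndG Goo]] := sigma_finiteT mu.
exists (fun i => @tuple_uncons n @^-1` (F i `*` G i)).
  rewrite -preimage_bigcup (_ : \bigcup_i _ = setT) ?preimage_setT//.
  rewrite -setXTT TF TG predeqE => -[x y]; split.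
    by move=> [i _ []/= ? ?]; split; exists i.
  move=> [/= [i _ Fix] [k _ Gky]]; exists (maxn i k) => //; split.
  - by move: x Fix; exact/subsetPset/ndF/leq_maxl.
  - by move: y Gky; exact/subsetPset/ndG/leq_maxr.
move=> i; have [mF Fi] := Foo i; have [mG Gi] := Goo i; split.
  rewrite -[X in measurable X]setTI; apply: measurable_tuple_uncons => //.
  exact: measurableX.
rewrite /= /lebesgue_tuple_step /pushforward -comp_preimage.
rewrite (_ : _ \o _ = id); last by apply/funext => p; exact: tuple_consK.
by rewrite preimage_id product_measure1E// lte_mul_pinfty// ge0_fin_numE.
Qed.

HB.instance Definition _ :=
  Measure_isSigmaFinite.Build _ _ _ (lebesgue_tuple_step mu) step_sigma_finite.

End step.

Fixpoint lebesgue_tuple n : {sigma_finite_measure set (n.-tuple mR) -> \bar R} :=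
  match n with
  | 0 => [the {sigma_finite_measure set _ -> \bar R} of dirac [tuple]]
  | m.+1 => [the {sigma_finite_measure set _ -> \bar R} of
              lebesgue_tuple_step (lebesgue_tuple m)]
  end.

Lemma lebesgue_tupleS n (A : set (n.+1.-tuple (measurableTypeR R))) :
  lebesgue_tuple n.+1 A =
  (@lebesgue_measure R \x lebesgue_tuple n)%E (@tuple_cons n @^-1` A).
Proof. by []. Qed.
Lemma lebesgue_tuple_box n (A : 'I_n -> set (measurableTypeR R)) :
  (forall i, measurable (A i)) ->
  lebesgue_tuple n [set t | forall i, A i (tnth t i)] =
  (\prod_(i < n) lebesgue_measure (A i))%E.
Proof.
elim: n A => [|n IHn] A mA.
  rewrite big_ord0 /= diracE mem_set//= => -[].
  by [].
rewrite big_ord_recl -(IHn (fun i => A (lift ord0 i)))// lebesgue_tupleS.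
rewrite (_ : _ @^-1` _ =
    A ord0 `*` [set t | forall i, A (lift ord0 i) (tnth t i)]).
  rewrite product_measure1E//=.
  rewrite (_ : [set _ | _] = \bigcap_(i in setT) ((@tnth _ _)^~ i @^-1` A (lift ord0 i))).
    apply: fin_bigcap_measurable => // i _; rewrite -[X in measurable X]setTI.
    exact: measurable_tnth.
  by apply/seteqP; split=> t /= + i; [move/(_ i) => + _|move/(_ i I)].
apply/seteqP; split=> -[x t] /=.
  move=> H; split; first exact: (H ord0).
  by move=> i; have := H (lift ord0 i); rewrite tnthS.
by move=> [Hx Ht] i; have [j ->|->] := unliftP ord0 i; [rewrite tnthS|].
Qed.

End lebesgue_tuple.


Section complex_analysis.
Context {R : realType}.
Local Notation C := (complex R).

Definition cintegral d (T : measurableType d)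
    (mu : {measure set T -> \bar R}) (D : set T) (f : T -> C) : C :=
  Complex (\int[mu]_(x in D) complex.Re (f x))
          (\int[mu]_(x in D) complex.Im (f x)).

(* C^o is C with the topology of the complex modulus. *)
Definition csummable (u : nat -> C) : Prop := cvgn (series (u : nat -> C^o)).
Definition csum (u : nat -> C) : C := limn (series (u : nat -> C^o)).

Definition cexp (z : C) : C :=
  real_complex R (expR (complex.Re z))
  * Complex (cos (complex.Im z)) (sin (complex.Im z)).

Definition tpow (z : C) (t : R) : C :=
  if 0 < t then cexp (z * real_complex R (ln t)) else 0.

Definition euler_Gamma (z : C) : C :=
  cintegral (@lebesgue_measure R) `]0, +oo[
    (fun t => tpow (z - 1) t * real_complex R (expR (- t))).

(* Least m such that 0 < Re z + m. *)
Definition Gamma_shift (z : C) : nat :=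
  if 0 < complex.Re z then 0%N else (Num.truncn (- complex.Re z)).+1.

(* Meromorphic continuation by the functional equation
   Gamma (z + m) = z (z + 1) ... (z + m - 1) Gamma z.  At the poles the
   denominator vanishes, hence Gamma z = 0 and (Gamma z)^-1 = 0, which is the
   value there of the entire function 1 / Gamma. *)
Definition Gamma (z : C) : C :=
  euler_Gamma (z + (Gamma_shift z)%:R)
  / \prod_(i < Gamma_shift z) (z + i%:R).

(* If a + 1 - k is a pole of Gamma, the coefficient is 0. *)
Definition gbinom (a : C) (k : nat) : C :=
  Gamma (a + 1) / (Gamma (k%:R + 1) * Gamma (a + 1 - k%:R)).

Definition cpower (z : C) (t : R) : C := tpow z t / Gamma (z + 1).

Definition bspline (z : C) (t : R) : C :=
  csum (fun k => (-1) ^+ k * gbinom (z + 1) k * cpower z (t - k%:R)).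

End complex_analysis.

Section schwartz.
Context {R : realType} (d : nat).

Definition iter_partial (s : seq 'I_d) (f : 'cV[R]_d -> R) : 'cV[R]_d -> R :=
  foldr (fun i g x => 'D_(delta_mx i ord0) g x) f s.

Definition smooth (f : 'cV[R]_d -> R) : Prop :=
  forall s : seq 'I_d, continuous (iter_partial s f) /\
    forall (i : 'I_d) x, derivable (iter_partial s f) x (delta_mx i ord0).

Definition schwartz_real (f : 'cV[R]_d -> R) : Prop :=
  smooth f /\
  forall (a : 'I_d -> nat) (s : seq 'I_d), exists K : R, forall x : 'cV[R]_d,
    `| (\prod_i x i ord0 ^+ a i) * iter_partial s f x | <= K.

(* R[i] is not a normed module over R in the library, so derivatives are taken
   componentwise. *)
Definition schwartz (phi : 'cV[R]_d -> complex R) : Prop :=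
  schwartz_real (fun x => complex.Re (phi x)) /\
  schwartz_real (fun x => complex.Im (phi x)).

End schwartz.

Section box_splines.
Context {R : realType} (d : nat).
Local Notation C := (complex R).
Local Notation test := ('cV[R]_d -> C).
(* A tempered distribution T is represented by phi |-> <T, phi>; only its
   values on Schwartz functions are meaningful. *)
Local Notation dist := (test -> C).

Definition direction_set n (M : 'M[R]_(d, n)) : Prop :=
  (forall j, col j M != 0) /\ row_full M^T.

Definition first_nonzero_pos n (M : 'M[R]_(d, n)) : Prop :=
  forall j, exists i : 'I_d,
    (forall i' : 'I_d, (i' < i)%N -> M i' j = 0) /\ 0 < M i j.

Definition orthant n : set (n.-tuple (measurableTypeR R)) :=
  [set t | forall i, 0 <= tnth t i].

Definition mxapp n (M : 'M[R]_(d, n)) (t : n.-tuple R) : 'cV[R]_d :=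
  M *m \col_j tnth t j.

Definition trunc_power n (z : 'I_n -> C) (M : 'M[R]_(d, n)) : dist := fun phi =>
  cintegral (lebesgue_tuple n) (@orthant n)
    (fun t => (\prod_j cpower (z j) (tnth t j)) * phi (mxapp M t)).

Definition box_spline n (z : 'I_n -> C) (M : 'M[R]_(d, n)) : dist := fun phi =>
  cintegral (lebesgue_tuple n) (@orthant n)
    (fun t => (\prod_j bspline (z j) (tnth t j)) * phi (mxapp M t)).

Definition transl (v : 'cV[R]_d) (T : dist) : dist :=
  fun phi => T (fun x => phi (x + v)).

Definition bdiff_term (a : C) (m : 'cV[R]_d) (T : dist) (phi : test) (k : nat) : C :=
  (-1) ^+ k * gbinom a k * transl (k%:R *: m) T phi.

Definition bdiff (a : C) (m : 'cV[R]_d) (T : dist) : dist :=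
  fun phi => csum (bdiff_term a m T phi).

(* The series defining bdiff a m T converges in the weak sense on S(R^d). *)
Definition bdiff_cvg (a : C) (m : 'cV[R]_d) (T : dist) : Prop :=
  forall phi, schwartz phi -> csummable (bdiff_term a m T phi).

(* nabla_{m_0}^{z_0+1} o ... o nabla_{m_{n-1}}^{z_{n-1}+1}, restricted to the
   factors whose index satisfies P. *)
Definition bdiff_prod n (z : 'I_n -> C) (M : 'M[R]_(d, n)) (P : pred 'I_n) :
    dist -> dist :=
  \big[comp/idfun]_(j < n | P j) bdiff (z j + 1) (col j M).

End box_splines.

(* Main.v *)
(* The coefficients c_k = (-1)^k binom(z + 1, k) are absolutely summable because
   Re z > -1, and B_z is the locally finite sum of the c_k k_z(t - k).  Moving
   the translation by k m_j from the test function to the j-th coordinate turns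
   one backward difference in direction m_j into the replacement of the factor
   k_{z_j}(t_j) by B_{z_j}(t_j) under the integral; iterating over j replaces
   all the factors.  Exchanging sum and integral is dominated convergence: the
   first nonzero entries of the columns being positive, the cone M R_+^{n+1} is
   pointed, so a Schwartz function satisfies
   |phi(M t)| <= K prod_j (1 + t_j)^{-N} on it, and everything is bounded by a
   product of one-variable integrals that do not depend on the translations. *)
Require Import Defs.
From HB Require Import structures.
From mathcomp Require Import all_boot all_order all_algebra.
From mathcomp Require Import complex.
From mathcomp Require Import all_classical all_reals all_analysis.
From mathcomp Require Import measurable_realfun.
From mathcomp Require Import ring lra.

Set Implicit Arguments.
Unset Strict Implicit.
Unset Printing Implicit Defensive.

Import Order.TTheory GRing.Theory Num.Theory.
Import numFieldNormedType.Exports.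

Local Open Scope classical_set_scope.
Local Open Scope ring_scope.

(** * Complex numbers and their l1 norm *)

(** The induction runs on two classes that absorb the translations. A coordinate factor is [tame]:
    it vanishes for t <= 0 and is integrable against a power of 1 / (1 + |t|). A test function phi
    enters only through its pullback t |-> phi(M t), which must be [dominated]: measurable, and
    bounded on the orthant by a constant times the product of the weights. So no translate of phi
    has to be shown to be a Schwartz function again; it is enough that its pullback stays dominated.
    A translation to the right does not increase the weighted integral of a tame factor, because the
    weight decreases on the half-line that carries the factor. Hence term k of a difference costs at
    most |c_k| times a bound free of k. With N an integer above all Re z_j, the exponent N + 2 makes
    t^(Re z_j) (1 + t)^-(N + 2) decay at least like t^-2, while Re z_j > -1 takes care of the
    singularity at 0. *)

Section complex_l1.
Context {R : realType}.
Local Notation C := (complex R).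
Implicit Types (z w : C).

(** Used in place of the modulus because [cintegral] works componentwise: it bounds both components
    and is submultiplicative. *)
Definition l1norm z : R := `|complex.Re z| + `|complex.Im z|.

Lemma l1norm_ge0 z : 0 <= l1norm z.
Proof. by rewrite addr_ge0. Qed.

Lemma l1norm0 : l1norm 0 = 0.
Proof. by rewrite /l1norm /= normr0 addr0. Qed.

Lemma l1norm1 : l1norm 1 = 1.
Proof. by rewrite /l1norm /= normr0 addr0 normr1. Qed.

Lemma ReM z w : complex.Re (z * w) =
  complex.Re z * complex.Re w - complex.Im z * complex.Im w.
Proof. by case: z; case: w. Qed.

Lemma ImM z w : complex.Im (z * w) =
  complex.Re z * complex.Im w + complex.Im z * complex.Re w.
Proof. by case: z; case: w. Qed.

Lemma ReD z w : complex.Re (z + w) = complex.Re z + complex.Re w.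
Proof. by case: z; case: w. Qed.

Lemma ImD z w : complex.Im (z + w) = complex.Im z + complex.Im w.
Proof. by case: z; case: w. Qed.

Lemma ReN z : complex.Re (- z) = - complex.Re z.
Proof. by case: z. Qed.

Lemma ImN z : complex.Im (- z) = - complex.Im z.
Proof. by case: z. Qed.

Lemma Re_sum I (r : seq I) (P : pred I) (F : I -> C) :
  complex.Re (\sum_(i <- r | P i) F i) = \sum_(i <- r | P i) complex.Re (F i).
Proof. by rewrite (big_morph _ ReD (erefl : complex.Re (0 : C) = 0)). Qed.

Lemma Im_sum I (r : seq I) (P : pred I) (F : I -> C) :
  complex.Im (\sum_(i <- r | P i) F i) = \sum_(i <- r | P i) complex.Im (F i).
Proof. by rewrite (big_morph _ ImD (erefl : complex.Im (0 : C) = 0)). Qed.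

Lemma Re_nat n : complex.Re (n%:R : C) = n%:R.
Proof. by elim: n => // n IHn; rewrite -!(addn1 n) !natrD ReD IHn. Qed.

Lemma Im_nat n : complex.Im (n%:R : C) = 0.
Proof. by elim: n => // n IHn; rewrite -!(addn1 n) !natrD ImD IHn addr0. Qed.

Lemma complex_eq z w : complex.Re z = complex.Re w -> complex.Im z = complex.Im w ->
  z = w.
Proof. by case: z; case: w => a b c e /= -> ->. Qed.

Lemma l1normM z w : l1norm (z * w) <= l1norm z * l1norm w.
Proof.
rewrite /l1norm ReM ImM mulrDl !mulrDr -!normrM.
rewrite (le_trans (lerD (ler_normB _ _) (ler_normD _ _)))//.
by rewrite le_eqVlt; apply/orP; left; apply/eqP; ring.
Qed.

Lemma l1norm_prod I (r : seq I) (F : I -> C) :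
  l1norm (\prod_(i <- r) F i) <= \prod_(i <- r) l1norm (F i).
Proof.
elim: r => [|i r IHr]; first by rewrite !big_nil l1norm1.
rewrite !big_cons (le_trans (l1normM _ _))// ler_wpM2l//.
exact: l1norm_ge0.
Qed.

Lemma l1norm_sum I (r : seq I) (F : I -> C) :
  l1norm (\sum_(i <- r) F i) <= \sum_(i <- r) l1norm (F i).
Proof.
by rewrite /l1norm Re_sum Im_sum big_split lerD// ler_norm_sum.
Qed.

Lemma Re_le_l1norm z : `|complex.Re z| <= l1norm z.
Proof. by rewrite lerDl. Qed.

Lemma Im_le_l1norm z : `|complex.Im z| <= l1norm z.
Proof. by rewrite lerDr. Qed.

Lemma l1norm_normc z : l1norm z <= 2 * Normc.normc z.
Proof.
rewrite mulr_natl mulr2n lerD//; case: z => a b /=; rewrite -sqrtr_sqr ler_wsqrtr//.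
  by rewrite lerDl sqr_ge0.
by rewrite lerDr sqr_ge0.
Qed.

Lemma normc_l1norm z : Normc.normc z <= l1norm z.
Proof.
case: z => a b; rewrite /l1norm /= -[leRHS]ger0_norm ?addr_ge0// -sqrtr_sqr.
rewrite ler_wsqrtr// sqrrD !real_normK ?num_real//.
by rewrite addrAC lerDl mulrn_wge0// mulr_ge0.
Qed.

Lemma cvg_complex (u : nat -> C) (a b : R) :
  (fun n => complex.Re (u n)) @ \oo --> a ->
  (fun n => complex.Im (u n)) @ \oo --> b ->
  (u : nat -> C^o) @ \oo --> (Complex a b : C^o).
Proof.
move=> ua ub; apply/cvgrPdist_lt => /= -[e e'].
(* In the order of C a positive number has zero imaginary part, so the radius is a positive real. *)
rewrite ltcE /= => /andP[/eqP -> e0].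
near=> n.
rewrite /Num.Def.normr/= ltcR (le_lt_trans (normc_l1norm _))//.
rewrite (splitr e) /l1norm ReD ReN ImD ImN /=; apply: ltrD; near: n.
  move/cvgrPdist_lt : ua; apply; exact: divr_gt0.
move/cvgrPdist_lt : ub; apply; exact: divr_gt0.
Unshelve. all: by end_near. Qed.

Lemma csum_complex (u : nat -> C) (a b : R) :
  series (fun n => complex.Re (u n)) @ \oo --> a ->
  series (fun n => complex.Im (u n)) @ \oo --> b ->
  csummable u /\ csum u = Complex a b.
Proof.
move=> ua ub.
have : series (u : nat -> C^o) @ \oo --> (Complex a b : C^o).
  apply: cvg_complex.
    by under eq_fun do rewrite /series/= Re_sum.
  by under eq_fun do rewrite /series/= Im_sum.
move=> h; split; first by apply/cvg_ex; exists (Complex a b).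
by apply: cvg_lim h; exact: norm_hausdorff.
Qed.

End complex_l1.

(** * The Gamma function at natural numbers *)

Section factorial_integral.
Context {R : realType}.
Local Notation C := (complex R).

(** Repeated integration by parts: the antiderivative of t^n exp(-t) that vanishes at infinity, so
    that minus its value at 0 is the integral. *)
Fixpoint exp_monomial_prim n (t : R) : R :=
  if n is m.+1 then m.+1%:R * exp_monomial_prim m t - t ^+ m.+1 * expR (- t)
  else - expR (- t).

Lemma is_derive_exp_monomial_prim n (t : R) :
  is_derive t 1 (exp_monomial_prim n) (t ^+ n * expR (- t)).
Proof.
have dN : is_derive t 1 (fun x : R => expR (- x)) (- expR (- t)).
  apply: is_derive_eq.
  by rewrite mulrN1.
elim: n => [|n IHn].
  rewrite (_ : exp_monomial_prim 0 = \- (fun x => expR (- x)))//.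
  by apply: is_derive_eq; rewrite opprK expr0 mul1r.
rewrite (_ : exp_monomial_prim n.+1 = n.+1%:R *: exp_monomial_prim n -
  (fun x : R => x ^+ n.+1) * (fun x => expR (- x)))//.
have dX : is_derive t 1 (fun x : R => x ^+ n.+1) (n.+1%:R * t ^+ n).
  split; first exact: exprn_derivable.
  by rewrite exp_derive /GRing.scale/= mulr1.
apply: is_derive_eq.
rewrite /GRing.scale/= exprS. ring.
Qed.

(** A single term of the exponential series gives x^(n+1) <= (n+1)! exp(x), hence the bound (n+1)! /
    x. *)
Lemma cvg_monomial_expRN n : x ^+ n * expR (- x) @[x --> +oo%R] --> (0 : R).
Proof.
have h0 : n.+1`!%:R * x^-1 @[x --> +oo%R] --> (0 : R).
  rewrite -(mulr0 (n.+1`!%:R)); apply: cvgMr.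
  apply/gtr0_cvgV0; last exact: cvg_id.
  exact: nbhs_pinfty_gt.
apply: (squeeze_cvgr _ (cvg_cst 0) h0).
near=> x.
have x0 : 0 < x by near: x; exact: nbhs_pinfty_gt.
rewrite mulr_ge0 ?expR_ge0 ?exprn_ge0 ?(ltW x0)//=.
rewrite expRN ler_pdivrMr ?expR_gt0// mulrAC ler_pdivlMr// -exprSr.
have := expR_ge1Dxn n (ltW x0).
rewrite -ler_pdivrMl ?ltr0n ?fact_gt0//; apply: le_trans.
by rewrite mulrC lerDr.
Unshelve. all: by end_near. Qed.

Lemma cvg_exp_monomial_prim n : exp_monomial_prim n x @[x --> +oo%R] --> (0 : R).
Proof.
elim: n => [|n IHn] /=.
  by rewrite -oppr0; apply: cvgN; exact: cvgr_expR.
rewrite -(subr0 0) -[X in X - _](mulr0 n.+1%:R); apply: cvgB.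
  exact: cvgMr.
exact: (@cvg_monomial_expRN n.+1).
Qed.

Lemma exp_monomial_prim0 n : exp_monomial_prim n 0 = - n`!%:R.
Proof.
elim: n => [|n IHn] /=; first by rewrite oppr0 expR0.
by rewrite IHn expr0n mul0r subr0 mulrN factS natrM.
Qed.

Lemma integral_monomial_expRN n :
  \int[@lebesgue_measure R]_(t in `]0, +oo[) (t ^+ n * expR (- t)) = n`!%:R.
Proof.
have cf : continuous (fun t : R => t ^+ n * expR (- t)).
  move=> t; apply: cvgM; first exact: exprn_continuous.
  by apply: continuous_comp; [exact: opp_continuous|exact: continuous_expR].
rewrite /Rintegral integral_itv_obnd_cbnd; last first.
  apply/measurable_EFinP; apply: measurable_funTS.
  exact: continuous_measurable_fun.
rewrite (@ge0_continuous_FTC2y _ _ (exp_monomial_prim n) 0 0).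
- by rewrite exp_monomial_prim0 -EFinB sub0r opprK.
- by move=> x x0; rewrite mulr_ge0 ?expR_ge0// exprn_ge0.
- exact: continuous_subspaceT.
- exact: cvg_exp_monomial_prim.
- by move=> x _; have [] := is_derive_exp_monomial_prim n x.
- have : {for 0, continuous (exp_monomial_prim n)}.
    apply/differentiable_continuous/derivable1_diffP.
    by have [] := is_derive_exp_monomial_prim n 0.
  by move=> h; exact: cvg_at_right_filter.
- move=> x _; rewrite derive1E.
  by have [_ ->] := is_derive_exp_monomial_prim n x.
Qed.

End factorial_integral.

(** * Summability of the generalized binomial coefficients *)

Section Gamma_facts.
Context {R : realType}.
Local Notation C := (complex R).
Implicit Types (w a : C).

Lemma tpow_nat n (t : R) : 0 < t -> tpow (n%:R : C) t = real_complex R (t ^+ n).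
Proof.
move=> t0; rewrite /tpow t0 /cexp ReM ImM Re_nat Im_nat /= !mulr0 mul0r subr0 addr0.
by rewrite cos0 sin0 expRM_natl lnK ?posrE// -[Complex 1 0]/(1 : C) mulr1.
Qed.

Lemma Gamma_natS n : Gamma (n%:R + 1 : C) = n`!%:R.
Proof.
rewrite /Gamma /Gamma_shift ReD Re_nat /= ltr_wpDl// big_ord0 divr1 addr0.
rewrite /euler_Gamma addrK /cintegral.
apply: complex_eq; rewrite ?Re_nat ?Im_nat /=.
  rewrite -integral_monomial_expRN; apply: eq_Rintegral => t.
  rewrite inE/= in_itv/= andbT => t0.
  by rewrite tpow_nat// ReM /= mulr0 subr0.
transitivity (\int[@lebesgue_measure R]_(t in `]0, +oo[) (0 : R)); last first.
  by rewrite /Rintegral integral0.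
apply: eq_Rintegral => t; rewrite inE/= in_itv/= andbT => t0.
by rewrite tpow_nat// ImM /= mulr0 mul0r addr0.
Qed.

Lemma Gamma_shiftS w : complex.Re w <= 0 ->
  Gamma_shift w = (Gamma_shift (w + 1)).+1.
Proof.
move=> w0; rewrite /Gamma_shift ltNge w0 /= ReD /=; congr _.+1.
have w0' : 0 <= - complex.Re w by rewrite oppr_ge0.
(* If [w + 1] lies in the open right half-plane, then 0 <= - Re w < 1 and the truncation is 0;
   otherwise the truncation of - Re w exceeds that of - Re (w + 1) by one. *)
case: ifPn => [h|].
  by apply: truncn_def; apply/andP; split; lra.
rewrite -leNgt => h.
have h1 : 0 <= - (complex.Re w + 1) by lra.
have /andP[h2 h3] := truncn_itv h1.
by apply: truncn_def; rewrite -!natr1; rewrite -natr1 in h3; apply/andP; split; lra.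
Qed.

(* At a pole both sides are 0. *)
Lemma Gamma_inv w : complex.Re w <= 0 -> (Gamma w)^-1 = w / Gamma (w + 1).
Proof.
move=> w0; rewrite /Gamma (Gamma_shiftS w0) big_ord_recl addr0.
rewrite (eq_bigr (fun i : 'I_(Gamma_shift (w + 1)) => w + 1 + i%:R)); last first.
  by move=> i _; rewrite -addrA -[1 + _]/(1%:R + _) -natrD.
rewrite -nat1r addrA.
by rewrite !invfM !invrK mulrCA mulrA.
Qed.

(** The hypothesis places [a - k] in the closed left half-plane, where [Gamma_inv] applies. Working
    with 1 / Gamma covers the poles: when [a] equals k, the coefficient of index k + 1 vanishes. *)
Lemma gbinomS a k : complex.Re a <= k%:R ->
  gbinom a k.+1 * k.+1%:R = gbinom a k * (a - k%:R).
Proof.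
move=> ak; rewrite /gbinom !Gamma_natS factS natrM.
have -> : a + 1 - k.+1%:R = a - k%:R by rewrite -natr1; ring.
have Rek : complex.Re (a - k%:R) <= 0 by rewrite ReD ReN Re_nat subr_le0.
have -> : a + 1 - k%:R = a - k%:R + 1 by ring.
have k0 : k.+1%:R != 0 :> C by rewrite pnatr_eq0.
rewrite [(_ * Gamma (a - k%:R))^-1]invfM (Gamma_inv Rek).
move: (Gamma _) (Gamma _) => x y.
rewrite !invfM; move: (x^-1) (k`!%:R^-1) (k.+1%:R : C) k0 => u v q q0.
by field.
Qed.

(* A form of Raabe's test: the recursion makes [k * u k] decrease by at least
   [e * u k], so the sum telescopes. *)
Lemma raabe_bounded (u : nat -> R) (e : R) N : 0 < e -> (forall k, 0 <= u k) ->
  (forall k, (N <= k)%N -> u k.+1 * k.+1%:R <= u k * (k%:R - e)) ->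
  exists K : R, forall n, \sum_(0 <= k < n) u k <= K.
Proof.
move=> e0 u0 H.
have key m : e * \sum_(N <= k < N + m) u k + (N + m)%:R * u (N + m)%N
   <= N%:R * u N.
  elim: m => [|m IHm]; first by rewrite addn0 big_geq// mulr0 add0r.
  rewrite addnS big_nat_recr ?leq_addr//= (le_trans _ IHm)//.
  have := H (N + m)%N (leq_addr _ _); lra.
exists (\sum_(0 <= k < N) u k + N%:R * u N / e) => n.
have : \sum_(0 <= k < n) u k <= \sum_(0 <= k < N + n) u k.
  rewrite (@big_cat_nat _ _ _ n 0 (N + n)) ?leq_addl//=.
  by rewrite lerDl sumr_ge0.
move=> /le_trans; apply; rewrite (@big_cat_nat _ _ _ N 0 (N + n)) ?leq_addr//=.
rewrite lerD2l ler_pdivlMr// mulrC (le_trans _ (key n))// lerDl mulr_ge0//.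
Qed.

(** The recursion calls for a multiplicative norm, hence the modulus here; passing to [l1norm] costs
    a factor 2. Raabe's test applies because |a - k| <= k - Re a / 2 for large k. *)
Lemma gbinom_summable a : 0 < complex.Re a ->
  exists K : R, forall n, \sum_(0 <= k < n) l1norm (gbinom a k) <= K.
Proof.
set e := complex.Re a => e0; set b := complex.Im a.
(* Beyond this threshold both [e <= k], required by [gbinomS], and e^2 + b^2 < k e hold; the latter
   yields (k - e)^2 + b^2 <= (k - e/2)^2. *)
pose N := (Num.truncn (e + (e ^+ 2 + b ^+ 2) / e)).+1.
have [K HK] : exists K : R, forall n,
    \sum_(0 <= k < n) Normc.normc (gbinom a k) <= K.
  apply: (@raabe_bounded _ (e / 2) N); first exact: divr_gt0.
    by move=> k; case: (gbinom a k) => ? ?; exact: sqrtr_ge0.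
  move=> k Nk.
  have q0 : 0 <= (e ^+ 2 + b ^+ 2) / e.
    by rewrite divr_ge0 ?(ltW e0)// addr_ge0// sqr_ge0.
  have ltk : e + (e ^+ 2 + b ^+ 2) / e < k%:R.
    by rewrite (lt_le_trans (truncnS_gt _))// ler_nat.
  have ek : e <= k%:R by lra.
  have /(congr1 (@Normc.normc R)) := gbinomS ek.
  rewrite [LHS]Normc.normcM [RHS]Normc.normcM => E.
  have nk : Normc.normc (k.+1%:R : C) = k.+1%:R.
    have -> : (k.+1%:R : C) = Complex k.+1%:R 0.
      by apply: complex_eq; rewrite ?Re_nat ?Im_nat.
    by rewrite /= expr0n addr0 sqrtr_sqr ger0_norm.
  rewrite -nk E; apply: ler_wpM2l.
    by case: (gbinom a k) => ? ?; exact: sqrtr_ge0.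
  have -> : a - k%:R = Complex (e - k%:R) b.
    by apply: complex_eq; rewrite ?ReD ?ImD ?ReN ?ImN ?Re_nat ?Im_nat ?oppr0 ?addr0.
  rewrite /= -[leRHS]ger0_norm; last lra.
  rewrite -sqrtr_sqr ler_wsqrtr//.
  have : e ^+ 2 + b ^+ 2 < k%:R * e.
    by rewrite -ltr_pdivrMr//; lra.
  nra.
exists (2 * K) => n; rewrite (le_trans _ (ler_wpM2l _ (HK n)))// mulr_sumr.
by apply: ler_sum => k _; exact: l1norm_normc.
Qed.

End Gamma_facts.

(** * Weighted integrability of truncated powers *)

Section cmeasurable.
Context {R : realType} d (T : measurableType d).
Local Notation C := (complex R).
Implicit Types (f g : T -> C).

Definition cmeasurable f : Prop :=
  measurable_fun [set: T] (fun x => complex.Re (f x)) /\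
  measurable_fun [set: T] (fun x => complex.Im (f x)).

Lemma cmeasurable_cst (c : C) : cmeasurable (fun=> c).
Proof. by split; exact: measurable_cst. Qed.

Lemma cmeasurableM f g : cmeasurable f -> cmeasurable g ->
  cmeasurable (fun x => f x * g x).
Proof.
move=> [f1 f2] [g1 g2]; split.
  under eq_fun do rewrite ReM.
  by apply: measurable_funB; exact: measurable_funM.
under eq_fun do rewrite ImM.
by apply: measurable_funD; exact: measurable_funM.
Qed.

Lemma cmeasurable_prod I (r : seq I) (F : I -> T -> C) :
  (forall i, cmeasurable (F i)) -> cmeasurable (fun x => \prod_(i <- r) F i x).
Proof.
move=> mF; elim: r => [|i r IHr].
  by under eq_fun do rewrite big_nil; exact: cmeasurable_cst.
by under eq_fun do rewrite big_cons; exact: cmeasurableM.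
Qed.

Lemma measurable_l1norm f : cmeasurable f ->
  measurable_fun [set: T] (fun x => l1norm (f x)).
Proof.
by move=> [f1 f2]; apply: measurable_funD; exact: measurableT_comp.
Qed.

End cmeasurable.

Lemma cmeasurable_comp {R : realType} d d' (T : measurableType d)
    (T' : measurableType d') (f : T' -> complex R) (g : T -> T') :
  cmeasurable f -> measurable_fun [set: T] g -> cmeasurable (fun x => f (g x)).
Proof.
by move=> [f1 f2] mg; split;
  [exact: (measurableT_comp f1 mg)|exact: (measurableT_comp f2 mg)].
Qed.

Section weight.
Context {R : realType}.
Local Notation C := (complex R).
Local Notation mu := (@lebesgue_measure R).

Definition weight (N : nat) (t : R) : R := (1 + `|t|)^-1 ^+ N.

Lemma weight_ge0 N t : 0 <= weight N t.
Proof. by rewrite exprn_ge0// invr_ge0 addr_ge0. Qed.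

Lemma weight_le N s t : 0 <= s -> s <= t -> weight N t <= weight N s.
Proof.
move=> s0 st; have t0 := le_trans s0 st.
apply: lerXn2r; rewrite ?nnegrE ?invr_ge0 ?addr_ge0//.
by rewrite lef_pV2 ?posrE ?ltr_wpDr// lerD2l !ger0_norm.
Qed.

Lemma measurable_weight N : measurable_fun [set: R] (weight N).
Proof.
apply: measurable_funX; apply: continuous_measurable_fun => t.
apply: cvgV; first by rewrite gt_eqF// ltr_wpDr.
by apply: cvgD; [exact: cvg_cst|exact: norm_continuous].
Qed.

Lemma measurable_powR_weight (a : R) N :
  measurable_fun [set: R] (fun t : R => t `^ a * weight N t).
Proof.
by apply: measurable_funM; [exact: measurable_powR|exact: measurable_weight].
Qed.

(* [(t / (1 + t)) ^ (a + 1) / (a + 1)] is a primitive of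
   [t ^ a * (1 + t) ^ (- a - 2)]. *)
Lemma integral_powR_weight_ge (a e : R) N : -1 < a -> a <= N%:R -> 0 < e ->
  (\int[mu]_(t in `[e, +oo[) (t `^ a * weight N.+2 t)%:E <= (a + 1)^-1%:E)%E.
Proof.
move=> a1 aN e0.
have a10 : 0 < a + 1 by lra.
pose f (t : R) := (t / (1 + t)) `^ a * (1 + t) ^- 2.
pose F (t : R) := (a + 1)^-1 * (t / (1 + t)) `^ (a + 1).
have quot0 (t : R) : 0 < t -> 0 < t / (1 + t).
  by move=> t0; rewrite divr_gt0// addr_gt0.
have dF (t : R) : 0 < t -> is_derive t 1 F (f t).
  move=> t0; have t10 : 1 + t != 0 by rewrite gt_eqF// addr_gt0.
  have dq : is_derive t 1 (fun t : R => t / (1 + t)) ((1 + t) ^- 2).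
    have dV : is_derive t 1 (fun t : R => (1 + t)^-1) (- (1 + t) ^- 2).
      have d1 : is_derive t 1 (fun x : R => 1 + x) 1.
        have := is_deriveD (is_derive_cst (1 : R) t (1 : R)) (is_derive_id t 1).
        by rewrite add0r; exact.
      have := is_deriveV t10 d1; rewrite /GRing.scale/= mulr1.
      exact.
    apply: is_derive_eq.
    by rewrite /GRing.scale/=; field.
  rewrite /F /f.
  have := is_derive1_powR (a + 1) (quot0 _ t0); rewrite addrK => dp.
  have dc := @is_derive1_comp _ _ (fun x : R => x / (1 + x)) _ _ _ dp dq.
  have := is_deriveZ (a + 1)^-1 dc; rewrite /GRing.scale/= !mulrA.
  by rewrite mulVf ?gt_eqF// mul1r; exact.
have der_cont (g : R -> R) t : derivable g t 1 -> {for t, continuous g}.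
  by move=> dg; exact/differentiable_continuous/derivable1_diffP.
have cf (t : R) : 0 < t -> {for t, continuous f}.
  move=> t0; have t10 : 1 + t != 0 by rewrite gt_eqF// addr_gt0.
  have c1 : (1 + x) @[x --> t] --> (1 + t : R).
    by apply: cvgD; [exact: cvg_cst|exact: cvg_id].
  apply: cvgM; last first.
    apply: cvgV; first by rewrite expf_neq0.
    by apply: (@cvg_comp _ _ _ _ (fun x : R => x ^+ 2) _ _ _ c1);
      exact: exprn_continuous.
  apply: (@cvg_comp _ _ _ (fun x : R => x / (1 + x)) (fun x => x `^ a)
    _ (nbhs (t / (1 + t)))).
    by apply: cvgM; [exact: cvg_id|exact: cvgV].
  have [dp _] := is_derive1_powR a (quot0 _ t0); exact: (der_cont _ _ dp).
have dF1 (t : R) : 0 < t -> derivable F t 1 by move=> t0; have [] := dF _ t0.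
have wc : {within `[e, +oo[, continuous f}.
  apply/continuous_within_itvcyP; split.
    by move=> x; rewrite in_itv/= andbT => ex; apply: cf; exact: lt_trans ex.
  exact: cvg_at_right_filter (cf _ e0).
have fF : (\int[mu]_(t in `[e, +oo[) (f t)%:E = (a + 1)^-1%:E - (F e)%:E)%E.
  apply: ge0_continuous_FTC2y.
  - move=> x ex; rewrite mulr_ge0 ?powR_ge0// invr_ge0 exprn_ge0//.
    by rewrite addr_ge0// (le_trans (ltW e0)).
  - exact: wc.
  - suff h : (x / (1 + x)) `^ (a + 1) @[x --> +oo%R] --> (1 : R) `^ (a + 1).
      have := cvgM (cvg_cst (a + 1)^-1) h; rewrite powR1 mulr1; exact.
    have [dp _] := is_derive1_powR (a + 1) (@ltr01 R).
    suff q1 : x / (1 + x) @[x --> +oo%R] --> (1 : R).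
      exact: (cvg_comp _ _ q1 (der_cont _ _ dp)).
    have : 1 - (1 + x)^-1 @[x --> +oo%R] --> (1 - 0 : R).
      apply: cvgB; first exact: cvg_cst.
      apply/gtr0_cvgV0.
        by near=> x; rewrite addr_gt0//; near: x; exact: nbhs_pinfty_gt.
      apply/cvgryPge => A; by near=> x; rewrite ler_wpDl.
    rewrite subr0; apply: cvg_trans; apply: near_eq_cvg; near=> x.
    have x0 : 0 < x by near: x; exact: nbhs_pinfty_gt.
    by field; rewrite gt_eqF// addr_gt0.
  - by move=> x ex; apply: dF1; exact: lt_trans ex.
  - by apply: cvg_at_right_filter; apply: der_cont; exact: dF1.
  - move=> x; rewrite in_itv/= andbT => ex; rewrite derive1E.
    by have [_ ->] := dF _ (lt_trans e0 ex).
have mf : measurable_fun `[e, +oo[ f.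
  by apply: subspace_continuous_measurable_fun wc.
apply: (@le_trans _ _ (\int[mu]_(t in `[e, +oo[) (f t)%:E)%E).
  apply: ge0_le_integral => //.
  - by move=> t _; rewrite lee_fin mulr_ge0 ?powR_ge0 ?weight_ge0.
  - apply/measurable_EFinP/measurable_funTS; exact: measurable_powR_weight.
  - exact/measurable_EFinP.
  - move=> t /=; rewrite in_itv/= andbT => et; rewrite lee_fin /f.
    have t0 := lt_le_trans e0 et; have t10 : 0 < 1 + t by rewrite addr_gt0.
    (* Once t^a and two factors 1 / (1 + t) are split off, what remains is (1 + t)^-N <= (1 + t)^-a,
       true since a <= N. *)
    rewrite /weight gtr0_norm// powRM ?invr_ge0 ?(ltW t0) ?(ltW t10)//.
    rewrite -mulrA ler_wpM2l ?powR_ge0// -exprVn -addn2 exprD.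
    rewrite ler_wpM2r ?exprn_ge0 ?invr_ge0 ?(ltW t10)//.
    rewrite -powR_mulrn ?invr_ge0 ?(ltW t10)// -powR_inv1 ?(ltW t10)//.
    by rewrite -!powRrM !mulN1r ler_powR ?lerN2// lerDl ltW.
rewrite fF -EFinB lee_fin gerBl mulr_ge0 ?powR_ge0 ?invr_ge0 ?(ltW a10)//.
Unshelve. all: by end_near. Qed.

(** For a < 0 the integrand is singular at 0, so the fundamental theorem is applied on [e, +oo[
    only; the bound there is uniform in e and survives the exhaustion of the open half-line. *)
Lemma integral_powR_weight (a : R) N : -1 < a -> a <= N%:R ->
  (\int[mu]_(t in `]0%R, +oo[) (t `^ a * weight N.+2 t)%:E <= (a + 1)^-1%:E)%E.
Proof.
move=> a1 aN.
pose D n : set R := `[n.+1%:R^-1, +oo[%classic.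
have -> : `]0%R, +oo[%classic = \bigcup_n D n.
  apply/seteqP; split => t /=; rewrite in_itv/= andbT; last first.
    by move=> [n _]; rewrite /D/= in_itv/= andbT;
      apply: lt_le_trans; rewrite invr_gt0.
  move=> t0; exists (Num.truncn t^-1) => //; rewrite /D/= in_itv/= andbT.
  by rewrite invf_ple ?posrE// ltW// truncnS_gt.
have mw A : measurable_fun A (fun t : R => (t `^ a * weight N.+2 t)%:E).
  by apply/measurable_EFinP/measurable_funTS; exact: measurable_powR_weight.
have h : (\int[mu]_(t in D n) (t `^ a * weight N.+2 t)%:E)%E @[n --> \oo] -->
  (\int[mu]_(t in \bigcup_n D n) (t `^ a * weight N.+2 t)%:E)%E.
  apply: ge0_nondecreasing_set_cvg_integral => //.
  - move=> m n mn; rewrite subsetEset => t /=; rewrite /D/= !in_itv/= !andbT.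
    by apply: le_trans; rewrite lef_pV2 ?posrE// ler_nat.
  - by move=> n; exact: measurable_itv.
  - by move=> n; exact: mw.
  - by move=> n t _; rewrite lee_fin mulr_ge0 ?powR_ge0 ?weight_ge0.
rewrite -(cvg_lim (@ereal_hausdorff R) h); apply: lime_le.
  by apply/cvg_ex; eexists; exact: h.
by apply: nearW => n; apply: integral_powR_weight_ge => //; rewrite invr_gt0.
Qed.
End weight.

Lemma cmeasurable_sum {R : realType} d (T : measurableType d) I (r : seq I)
    (F : I -> T -> complex R) : (forall i, cmeasurable (F i)) ->
  cmeasurable (fun x => \sum_(i <- r) F i x).
Proof.
move=> mF; split.
  under eq_fun do rewrite Re_sum.
  by apply: measurable_sum => i; have [] := mF i.
under eq_fun do rewrite Im_sum.
by apply: measurable_sum => i; have [] := mF i.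
Qed.

(** Meant for locally finite sums, whose partial sums are eventually constant at every point. *)
Lemma cmeasurable_near_eq {R : realType} d (T : measurableType d)
    (F : nat -> T -> complex R) (f : T -> complex R) :
  (forall n, cmeasurable (F n)) ->
  (forall x, exists n0, forall n, (n0 <= n)%N -> F n x = f x) -> cmeasurable f.
Proof.
move=> mF Ff; split.
  apply: (@measurable_fun_cvg _ _ _ _ (fun n x => complex.Re (F n x))).
    by move=> n; have [] := mF n.
  move=> x _; apply: cvg_near_cst; have [n0 h] := Ff x.
  by exists n0 => // n /= n0n; rewrite h.
apply: (@measurable_fun_cvg _ _ _ _ (fun n x => complex.Im (F n x))).
  by move=> n; have [] := mF n.
move=> x _; apply: cvg_near_cst; have [n0 h] := Ff x.
by exists n0 => // n /= n0n; rewrite h.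
Qed.

(** * Translation invariance of Lebesgue measure on the line *)

Section translation.
Context {R : realType}.
Local Notation mu := (@lebesgue_measure R).

Lemma lebesgue_measure_shift (c : R) (A : set R) : measurable A ->
  pushforward mu ((fun x => x + c) : _ -> measurableTypeR R) A = mu A.
Proof.
move=> mA.
have mc : measurable_fun [set: measurableTypeR R]
    ((fun x => x + c) : measurableTypeR R -> measurableTypeR R).
  exact: measurable_funD.
pose phi : {mfun measurableTypeR R >-> measurableTypeR R} :=
  HB.pack ((fun x => x + c) : measurableTypeR R -> measurableTypeR R)
    (isMeasurableFun.Build _ _ _ _ _ mc).
apply/esym/(@lebesgue_measure_unique _ (pushforward mu phi)) => //= _ [[a b]] _ <-.
rewrite /pushforward/=.
rewrite (_ : _ @^-1` _ = `]a - c, b - c]%classic); last first.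
  by apply/seteqP; split => x /=; rewrite !in_itv/= ltrBlDr lerBrDr.
rewrite !lebesgue_measure_itv/= !lte_fin ltrD2r -!EFinB.
by congr (if _ then _%:E else _); ring.
Qed.

Lemma ge0_integral_shift (c : R) (f : R -> \bar R) : measurable_fun [set: R] f ->
  (forall x, 0 <= f x)%E -> (\int[mu]_x f (x + c)%R = \int[mu]_x f x)%E.
Proof.
move=> mf f0.
have mc : measurable_fun [set: measurableTypeR R]
    ((fun x => x + c) : measurableTypeR R -> measurableTypeR R).
  exact: measurable_funD.
rewrite -[LHS](@ge0_integral_pushforward _ _ _ _ _ _ mc mu setT f)//.
by apply: eq_measure_integral => A mA _; exact: lebesgue_measure_shift.
Qed.

End translation.

Section csum_finite.
Context {R : realType}.
Local Notation C := (complex R).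

Lemma csum_finite (u : nat -> C) n : (forall k, (n <= k)%N -> u k = 0) ->
  csummable u /\ csum u = \sum_(0 <= k < n) u k.
Proof.
move=> u0.
have h : series (u : nat -> C^o) @ \oo --> (\sum_(0 <= k < n) u k : C^o).
  apply: cvg_near_cst; near=> m.
  have nm : (n <= m)%N by near: m; exact: nbhs_infty_ge.
  apply/eqP; rewrite /series/= (@big_cat_nat _ _ _ n 0 m)//= [X in _ + X]big1_seq ?addr0//.
  by move=> k /=; rewrite mem_index_iota => /andP[nk _]; exact: u0.
split; first by apply/cvg_ex; eexists; exact: h.
by apply: cvg_lim h; exact: norm_hausdorff.
Unshelve. all: by end_near. Qed.

End csum_finite.

(** * Weighted integrable functions on the half-line *)

Section tame.
Context {R : realType}.
Local Notation C := (complex R).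
Local Notation mu := (@lebesgue_measure R).

(** Vanishing for t <= 0 has two uses: sums of right translates become locally finite, and right
    translation does not increase the weighted integral. *)
Definition tame N (b : R -> C) : Prop :=
  [/\ cmeasurable b, forall t, t <= 0 -> b t = 0 &
      (\int[mu]_t (l1norm (b t) * weight N t)%:E < +oo)%E].

Lemma measurable_tame N b : tame N b ->
  measurable_fun [set: R] (fun t => (l1norm (b t) * weight N t)%:E).
Proof.
move=> [mb _ _]; apply/measurable_EFinP.
by apply: measurable_funM; [exact: measurable_l1norm|exact: measurable_weight].
Qed.

Lemma tame_ge0 N (b : R -> C) t : 0 <= l1norm (b t) * weight N t.
Proof. by rewrite mulr_ge0 ?l1norm_ge0 ?weight_ge0. Qed.

Lemma cmeasurable_cpower (z : C) : cmeasurable (cpower z : R -> C).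
Proof.
rewrite /cpower; apply: cmeasurableM; last exact: cmeasurable_cst.
have mlt : measurable_fun [set: R] (fun t : R => 0 < t).
  exact: measurable_fun_ltr.
have ml (c : R) : measurable_fun [set: R] (fun t : R => c * ln t).
  by apply: measurable_funM => //; exact: measurable_cst.
have me : measurable_fun [set: R] (fun t : R => expR (complex.Re z * ln t)).
  exact: measurableT_comp.
have tpowE (t : R) : tpow z t = if 0 < t then
    Complex (expR (complex.Re z * ln t) * cos (complex.Im z * ln t))
            (expR (complex.Re z * ln t) * sin (complex.Im z * ln t))
    else 0.
  rewrite /tpow; case: ifP => // _.
  by apply: complex_eq; rewrite /cexp !(ReM, ImM) /= !mulr0 !mul0r ?subr0 ?add0r ?addr0.
split.
  rewrite (_ : (fun t => _) = (fun t => if 0 < t then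
     expR (complex.Re z * ln t) * cos (complex.Im z * ln t) else 0)); last first.
    by apply/funext => t; rewrite tpowE; case: ifP.
  apply: measurable_fun_ifT => //; apply: measurable_funM => //.
  apply: (measurableT_comp _ (ml _)).
  by apply: continuous_measurable_fun; exact: continuous_cos.
rewrite (_ : (fun t => _) = (fun t => if 0 < t then
   expR (complex.Re z * ln t) * sin (complex.Im z * ln t) else 0)); last first.
  by apply/funext => t; rewrite tpowE; case: ifP.
apply: measurable_fun_ifT => //; apply: measurable_funM => //.
apply: (measurableT_comp _ (ml _)).
by apply: continuous_measurable_fun; exact: continuous_sin.
Qed.

Lemma cpower_tame (z : C) N : -1 < complex.Re z -> complex.Re z <= N%:R ->
  tame N.+2 (cpower z).
Proof.
move=> z1 zN; split; first exact: cmeasurable_cpower.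
  by move=> t t0; rewrite /cpower /tpow ltNge t0 mul0r.
(* The 2 bounds |cos| + |sin| in the [l1norm] of the complex exponential. *)
pose a := complex.Re z; pose K := 2 * l1norm (Gamma (z + 1))^-1.
have K0 : 0 <= K by rewrite mulr_ge0 ?l1norm_ge0.
have mf : measurable_fun [set: R] (fun t => (K * (t `^ a * weight N.+2 t))%:E).
  by apply/measurable_EFinP/measurable_funM => //; exact: measurable_powR_weight.
apply: (@le_lt_trans _ _
  (\int[mu]_(t in `]0%R, +oo[) (K * (t `^ a * weight N.+2 t))%:E)%E).
  rewrite [leRHS]integral_mkcond; apply: ge0_le_integral => //.
  - by move=> t _; rewrite lee_fin tame_ge0.
  - apply/measurable_EFinP/measurable_funM; last exact: measurable_weight.
    exact/measurable_l1norm/cmeasurable_cpower.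
  - apply: (measurable_restrictT _ _).1 => //; exact: (measurable_funTS mf).
  - move=> t _; rewrite patchE; have [t0|t0] := ltP 0 t.
      rewrite mem_set/= ?in_itv/= ?t0//.
      rewrite lee_fin mulrA ler_wpM2r ?weight_ge0//.
      rewrite /cpower (le_trans (l1normM _ _))// /K mulrAC ler_wpM2r ?l1norm_ge0//.
      rewrite /tpow t0 /l1norm /cexp !(ReM, ImM) /= !mulr0 !mul0r !subr0 !add0r.
      rewrite addr0 !normrM (ger0_norm (expR_ge0 _)) -mulrDr mulrC /powR gt_eqF//.
      rewrite ler_wpM2r ?expR_ge0// lerD// ler_norml.
        by rewrite cos_geN1 cos_le1.
      by rewrite sin_geN1 sin_le1.
    rewrite memNset/= ?in_itv/= ?andbT; last by rewrite ltNge t0.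
    by rewrite /cpower /tpow ltNge t0 mul0r l1norm0 mul0r.
under eq_integral do rewrite EFinM.
rewrite ge0_integralZl//; last 2 first.
- by apply/measurable_EFinP/measurable_funTS; exact: measurable_powR_weight.
- by move=> t _; rewrite lee_fin mulr_ge0 ?powR_ge0 ?weight_ge0.
rewrite (@le_lt_trans _ _ (K%:E * (a + 1)^-1%:E)%E) ?ltry//.
by rewrite lee_wpmul2l ?lee_fin// integral_powR_weight.
Qed.

(** Substituting t + k for t moves the shift onto the weight, which decreases for t > 0, while [b]
    vanishes elsewhere. *)
Lemma integral_tame_shift N b (k : nat) : tame N b ->
  (\int[mu]_t (l1norm (b (t - k%:R)) * weight N t)%:E <=
   \int[mu]_t (l1norm (b t) * weight N t)%:E)%E.
Proof.
move=> tb; have [mb b0 _] := tb.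
pose f (t : R) := (l1norm (b t) * weight N (t + k%:R))%:E.
have mf : measurable_fun [set: R] f.
  apply/measurable_EFinP/measurable_funM; first exact: measurable_l1norm.
  by apply: (measurableT_comp (measurable_weight N)); exact: measurable_funD.
rewrite (_ : (\int[mu]_t _)%E = \int[mu]_t f (t + - k%:R)%R)%E; last first.
  by apply: eq_integral => t _; rewrite /f subrK.
rewrite ge0_integral_shift//; last first.
  by move=> t; rewrite lee_fin mulr_ge0 ?l1norm_ge0 ?weight_ge0.
apply: ge0_le_integral => //.
- by move=> t _; rewrite lee_fin mulr_ge0 ?l1norm_ge0 ?weight_ge0.
- exact: measurable_tame.
- move=> t _; rewrite lee_fin; have [t0|t0] := leP t 0.
    by rewrite b0// l1norm0 !mul0r.
  by rewrite ler_wpM2l ?l1norm_ge0// weight_le ?lerDl// ltW.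
Qed.

Definition shift_sum (c : nat -> C) (b : R -> C) (t : R) : C :=
  csum (fun k => c k * b (t - k%:R)).

Lemma shift_sum_finite N c b t n : tame N b -> t <= n%:R ->
  csummable (fun k => c k * b (t - k%:R)) /\
  shift_sum c b t = \sum_(0 <= k < n) c k * b (t - k%:R).
Proof.
move=> [_ b0 _] tn; apply: csum_finite => k nk; rewrite b0 ?mulr0//.
by rewrite subr_le0 (le_trans tn)// ler_nat.
Qed.

Lemma cmeasurable_shift (b : R -> C) (c : R) : cmeasurable b ->
  cmeasurable (fun t : R => b (t - c)).
Proof.
by move=> mb; apply: (cmeasurable_comp mb); exact: measurable_funB.
Qed.

(** The triangle inequality in weighted L^1: every translate has mass at most that of [b], so the
    sum has mass at most K times it. This is how B_z inherits tameness from k_z. *)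
Lemma tame_shift_sum N c b (K : R) :
  (forall n, \sum_(0 <= k < n) l1norm (c k) <= K) -> tame N b ->
  tame N (shift_sum c b).
Proof.
move=> cK tb; have [mb b0 bN] := tb.
have fin t := shift_sum_finite c tb (ltW (truncnS_gt t)).
have mterm k : cmeasurable (fun t : R => c k * b (t - k%:R)).
  by apply: cmeasurableM; [exact: cmeasurable_cst|exact: cmeasurable_shift].
have mB : cmeasurable (shift_sum c b).
  apply: (cmeasurable_near_eq
    (F := fun n (t : R) => \sum_(0 <= k < n) c k * b (t - k%:R))).
    by move=> n; exact: cmeasurable_sum.
  move=> t; exists (Num.truncn t).+1 => n tn.
  have tn' : t <= n%:R by rewrite (le_trans (ltW (truncnS_gt t)))// ler_nat.
  by rewrite (shift_sum_finite c tb tn').2.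
split => //.
  move=> t t0; have [_ ->] := @shift_sum_finite N c b t 0 tb t0.
  by rewrite big_geq.
pose g k (t : R) := (l1norm (c k) * (l1norm (b (t - k%:R)) * weight N t))%:E.
have g0 k t : (0 <= g k t)%E.
  by rewrite lee_fin !mulr_ge0 ?l1norm_ge0 ?weight_ge0.
have mbs k : measurable_fun [set: R] (fun t => (l1norm (b (t - k%:R)) * weight N t)).
  apply/measurable_funM; last exact: measurable_weight.
  exact/measurable_l1norm/cmeasurable_shift.
have mg k : measurable_fun [set: R] (g k).
  by apply/measurable_EFinP/measurable_funM => //; exact: measurable_cst.
apply: (@le_lt_trans _ _ (\int[mu]_t \sum_(k <oo) g k t)%E).
  apply: ge0_le_integral => //.
  - by move=> t _; rewrite lee_fin tame_ge0.
  - apply/measurable_EFinP/measurable_funM; last exact: measurable_weight.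
    exact: measurable_l1norm.
  - by apply: ge0_emeasurable_sum => // k _; exact: mg.
  - move=> t _; rewrite (fin t).2.
    (* At a fixed t only the indices k <= [Num.truncn t] contribute, so the finite triangle
       inequality suffices. *)
    apply: (@le_trans _ _ (\sum_(0 <= k < (Num.truncn t).+1) g k t)%E); last first.
      exact: nneseries_lim_ge.
    rewrite sumEFin lee_fin (le_trans (ler_wpM2r (weight_ge0 _ _) (l1norm_sum _ _)))//.
    rewrite mulr_suml; apply: ler_sum => k _.
    by rewrite mulrA ler_wpM2r ?weight_ge0// l1normM.
rewrite integral_nneseries//.
set I := (\int[mu]_t (l1norm (b t) * weight N t)%:E)%E in bN.
have I0 : (0 <= I)%E by apply: integral_ge0 => t _; rewrite lee_fin tame_ge0.
apply: (@le_lt_trans _ _ (K%:E * I)%E); last first.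
  by rewrite -(@fineK _ I) ?ge0_fin_numE// -EFinM ltry.
apply: lime_le.
  by apply: is_cvg_nneseries => n _ _; apply: integral_ge0.
apply: nearW => n; apply: (@le_trans _ _ (\sum_(0 <= k < n) (l1norm (c k))%:E * I)%E).
  apply: lee_sum => k _; rewrite /g; under eq_integral do rewrite EFinM.
  rewrite ge0_integralZl//; last 3 first.
  - by apply/measurable_EFinP; exact: mbs.
  - by move=> t _; rewrite lee_fin mulr_ge0 ?l1norm_ge0 ?weight_ge0.
  - by rewrite lee_fin l1norm_ge0.
  by rewrite lee_wpmul2l ?lee_fin ?l1norm_ge0// integral_tame_shift.
rewrite -ge0_sume_distrl; last by move=> k _; rewrite lee_fin l1norm_ge0.
by rewrite sumEFin lee_wpmul2r// lee_fin.
Qed.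

End tame.

(** * Lebesgue measure on tuples *)

Section lebesgue_tuple_facts.
Context {R : realType}.
Local Notation mR := (measurableTypeR R).
Local Notation mu := (@lebesgue_measure R).

Definition tshift n (v : 'I_n -> R) (t : n.-tuple mR) : n.-tuple mR :=
  [tuple tnth t i + v i | i < n].

Lemma tnth_tshift n (v : 'I_n -> R) (t : n.-tuple mR) i :
  tnth (tshift v t) i = tnth t i + v i.
Proof. by rewrite tnth_mktuple. Qed.

Lemma measurable_tshift n (v : 'I_n -> R) : measurable_fun [set: _] (tshift v).
Proof.
apply/measurable_fun_tnthP => i.
rewrite (_ : _ \o _ = (fun t : n.-tuple mR => (tnth t i : mR) + v i)); last first.
  by apply/funext => t; rewrite /= tnth_tshift.
by apply: measurable_funD => //; exact: measurable_tnth.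
Qed.

(** Through [tuple_cons] the translation becomes a product of a translation of R and one of
    n-tuples, and a product of sigma-finite measures is determined by its values on rectangles. *)
Lemma lebesgue_tuple_shift n (v : 'I_n -> R) (A : set (n.-tuple mR)) :
  measurable A -> pushforward (lebesgue_tuple n) (tshift v) A = lebesgue_tuple n A.
Proof.
elim: n v A => [|n IHn] v A mA.
  rewrite /pushforward; congr (lebesgue_tuple 0 _).
  by apply/seteqP; split => t /=; rewrite (tuple0 (tshift v t)) (tuple0 t).
pose v' i := v (lift ord0 i).
pose s (p : mR * n.-tuple mR) : mR * n.-tuple mR := ((p.1 + v ord0 : mR), tshift v' p.2).
have ms : measurable_fun [set: mR * n.-tuple mR] s.
  apply: measurable_fun_pair.
    by apply: measurable_funD => //; exact: measurable_fst.
  by apply: (measurableT_comp (measurable_tshift v')); exact: measurable_snd.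
pose phi : {mfun (mR * n.-tuple mR)%type >-> (mR * n.-tuple mR)%type} :=
  HB.pack s (isMeasurableFun.Build _ _ _ _ _ ms).
have TE p : tshift v (tuple_cons p) = tuple_cons (s p).
  apply: eq_from_tnth => i; rewrite tnth_tshift.
  have [k ->|->] := unliftP ord0 i; last by rewrite !tnth0.
  by rewrite !tnthS tnth_tshift.
have E : @tuple_cons R n @^-1` (tshift v @^-1` A) = s @^-1` (@tuple_cons R n @^-1` A).
  by apply/funext => p; rewrite /preimage/= TE.
have mB : measurable (@tuple_cons R n @^-1` A).
  by rewrite -[X in measurable X]setTI; exact: measurable_tuple_cons.
have -> : pushforward (lebesgue_tuple n.+1) (tshift v) A =
    (mu \x lebesgue_tuple n)%E (s @^-1` (@tuple_cons R n @^-1` A)) by rewrite -E.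
rewrite lebesgue_tupleS.
move: (_ @^-1` A) mB => B mB {E A mA}.
apply/esym/(@product_measure_unique _ _ _ _ _ mu (lebesgue_tuple n)
  (pushforward (mu \x lebesgue_tuple n)%E phi)) => //.
move=> X Y mX mY.
transitivity ((mu \x lebesgue_tuple n)%E
    (((fun x : mR => x + v ord0 : mR) @^-1` X) `*` (tshift v' @^-1` Y))); first by [].
rewrite product_measure1E.
- by congr (_ * _)%E; [exact: lebesgue_measure_shift|exact: IHn].
- rewrite -[X in measurable X]setTI.
  have mc : measurable_fun [set: mR] (fun x : mR => x + v ord0 : mR).
    exact: measurable_funD.
  exact: mc.
- by rewrite -[X in measurable X]setTI; exact: measurable_tshift.
Qed.

Lemma integral_tshift n (v : 'I_n -> R) (f : n.-tuple mR -> \bar R) :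
  measurable_fun [set: n.-tuple mR] f ->
  (\int[lebesgue_tuple n]_t f (tshift v t) = \int[lebesgue_tuple n]_t f t)%E.
Proof.
have ge0 (g : n.-tuple mR -> \bar R) : measurable_fun [set: _] g ->
    (forall t, 0 <= g t)%E ->
    (\int[lebesgue_tuple n]_t g (tshift v t) = \int[lebesgue_tuple n]_t g t)%E.
  move=> mg g0.
  rewrite -[LHS](@ge0_integral_pushforward _ _ _ _ _ _
    (measurable_tshift v) (lebesgue_tuple n) setT g)//.
  apply: eq_measure_integral; first exact: measurable_tshift.
  by move=> ? A mA _; exact: lebesgue_tuple_shift.
move=> mf; rewrite integralE [RHS]integralE; congr (_ - _)%E.
  rewrite -[RHS](ge0 _ (measurable_funepos mf) (funepos_ge0 f)).
  by apply: eq_integral => t _; rewrite !funeposE.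
rewrite -[RHS](ge0 _ (measurable_funeneg mf) (funeneg_ge0 f)).
by apply: eq_integral => t _; rewrite !funenegE.
Qed.

Lemma integral_tuple_prod n (h : 'I_n -> R -> R) :
  (forall i, measurable_fun [set: R] (h i)) -> (forall i x, 0 <= h i x) ->
  (\int[lebesgue_tuple n]_t (\prod_(i < n) h i (tnth t i))%:E =
   \prod_(i < n) \int[mu]_x (h i x)%:E)%E.
Proof.
elim: n h => [|n IHn] h mh h0.
  rewrite big_ord0; under eq_integral do rewrite big_ord0.
  by rewrite [LHS]integral_cst//= mul1e diracT.
rewrite big_ord_recl.
have mprod m (g : 'I_m -> R -> R) : (forall i, measurable_fun [set: R] (g i)) ->
    measurable_fun [set: m.-tuple mR] (fun t => \prod_(i < m) g i (tnth t i)).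
  move=> mg; apply: measurable_prod => i _.
  by apply: (measurableT_comp (mg i)); exact: measurable_tnth.
transitivity (\int[mu \x lebesgue_tuple n]_p
   (\prod_(i < n.+1) h i (tnth (tuple_cons p) i))%:E)%E.
  rewrite -[RHS](@ge0_integral_pushforward _ _ _ _ _ _
    (@measurable_tuple_cons R n) (mu \x lebesgue_tuple n)%E setT
    (fun t => (\prod_(i < n.+1) h i (tnth t i))%:E))//.
    by apply/measurable_EFinP; exact: mprod.
  by move=> t _; rewrite lee_fin prodr_ge0.
rewrite fubini_tonelli1; last 2 first.
- apply/measurable_EFinP.
  exact: (measurableT_comp (mprod _ _ mh) (@measurable_tuple_cons R n)).
- by move=> p; rewrite lee_fin prodr_ge0.
rewrite -(IHn (fun i => h (lift ord0 i)))//.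
set c := (\int[lebesgue_tuple n]_t _)%E.
rewrite -ge0_integralZr//.
apply: eq_integral => x _; rewrite /fubini_F /c -ge0_integralZl_EFin//.
- apply: eq_integral => t _; rewrite big_ord_recl -EFinM.
  congr (_ * _)%:E.
  by apply: eq_bigr => i _; rewrite !(tnth_nth (0 : R)).
- by move=> t _; rewrite lee_fin prodr_ge0.
- by apply/measurable_EFinP; exact: (mprod _ (fun i => h (lift ord0 i))).
- by apply/measurable_EFinP; exact: mh.
- by move=> y _; rewrite lee_fin.
- by apply: integral_ge0 => t _; rewrite lee_fin prodr_ge0.
Qed.

End lebesgue_tuple_facts.

(** * Series of complex integrals *)

Section cintegral_series.
Context {R : realType} d (T : measurableType d) (mu : {measure set T -> \bar R}).
Local Notation C := (complex R).

Definition cintegrable (f : T -> C) : Prop :=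
  cmeasurable f /\ (\int[mu]_x (l1norm (f x))%:E < +oo)%E.

Lemma integrable_le (r g : T -> R) : measurable_fun [set: T] r ->
  measurable_fun [set: T] g -> (\int[mu]_x (g x)%:E < +oo)%E ->
  (forall x, `|r x| <= g x) -> mu.-integrable setT (EFin \o r).
Proof.
move=> mr mg ig rg; apply/integrableP; split; first exact/measurable_EFinP.
apply: le_lt_trans ig; apply: ge0_le_integral => //.
- by apply: measurableT_comp => //; exact/measurable_EFinP.
- exact/measurable_EFinP.
- by move=> x _; rewrite lee_fin.
Qed.

Lemma cintegrable_Re f : cintegrable f ->
  mu.-integrable setT (EFin \o (fun x => complex.Re (f x))).
Proof.
move=> [mf fi]; apply: (@integrable_le _ (fun x => l1norm (f x))) => //.
- by have [] := mf.
- exact: measurable_l1norm.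
- by move=> x; exact: Re_le_l1norm.
Qed.

Lemma cintegrable_Im f : cintegrable f ->
  mu.-integrable setT (EFin \o (fun x => complex.Im (f x))).
Proof.
move=> [mf fi]; apply: (@integrable_le _ (fun x => l1norm (f x))) => //.
- by have [] := mf.
- exact: measurable_l1norm.
- by move=> x; exact: Im_le_l1norm.
Qed.

Lemma cintegralZl (c : C) f : cintegrable f ->
  cintegral mu setT (fun x => c * f x) = c * cintegral mu setT f.
Proof.
move=> fi; have iR := cintegrable_Re fi; have iI := cintegrable_Im fi.
have iZ k r : mu.-integrable setT (EFin \o r) ->
    mu.-integrable setT (EFin \o (fun x => k * r x)).
  move=> ir; rewrite (_ : _ \o _ = (fun x => k%:E * (EFin \o r) x)%E).
    exact: integrableZl.
  by apply/funext => x /=; rewrite EFinM.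
apply: complex_eq; rewrite /cintegral ?ReM ?ImM /=.
  under eq_Rintegral do rewrite ReM.
  by rewrite RintegralB// ?RintegralZl//; exact: iZ.
under eq_Rintegral do rewrite ImM.
by rewrite RintegralD// ?RintegralZl//; exact: iZ.
Qed.

(** Dominated convergence for the partial sums, with dominating function the pointwise sum [G] of
    the [g k]; its integral is the sum of their integrals, finite by hypothesis. *)
Lemma cvg_series_Rintegral (r : nat -> T -> R) (s : T -> R) (g : nat -> T -> R) :
  (forall k, measurable_fun [set: T] (r k)) -> measurable_fun [set: T] s ->
  (forall k, measurable_fun [set: T] (g k)) ->
  (forall k x, `|r k x| <= g k x) ->
  (\sum_(k <oo) \int[mu]_x (g k x)%:E < +oo)%E ->
  (forall x, exists n0, forall n, (n0 <= n)%N -> \sum_(0 <= k < n) r k x = s x) ->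
  series (fun k => (\int[mu]_x r k x)%R) @ \oo --> (\int[mu]_x s x)%R.
Proof.
move=> mr ms mg rg ig rs.
have g0 k x : 0 <= g k x by exact: le_trans (rg k x).
have ge0 k : (0 <= \int[mu]_x (g k x)%:E)%E.
  by apply: integral_ge0 => x _; rewrite lee_fin.
have ir k : mu.-integrable setT (EFin \o r k).
  apply: (@integrable_le _ (g k)) => //; apply: le_lt_trans ig.
  apply: (@le_trans _ _ (\sum_(0 <= i < k.+1) \int[mu]_x (g i x)%:E)%E); last first.
    exact: nneseries_lim_ge.
  by rewrite big_nat_recr//= leeDr// sume_ge0.
pose f_ n x : \bar R := (\sum_(0 <= k < n) r k x)%:E.
pose G x : \bar R := (\sum_(k <oo) (g k x)%:E)%E.
have G0 x : (0 <= G x)%E by apply: nneseries_ge0 => k _ _; rewrite lee_fin.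
have iG : mu.-integrable setT G.
  apply/integrableP; split.
    apply: ge0_emeasurable_sum => [k x _ _|k _]; first by rewrite lee_fin.
    exact/measurable_EFinP.
  under eq_integral do rewrite gee0_abs//.
  rewrite integral_nneseries//; first by move=> k; exact/measurable_EFinP.
  by move=> k x _; rewrite lee_fin.
have mf_ n : measurable_fun [set: T] (f_ n).
  by apply/measurable_EFinP/measurable_sum.
have [||ints _ cv] := @dominated_convergence _ _ _ mu setT measurableT f_ (EFin \o s) G
  mf_ ((measurable_EFinP _ _).2 ms) _ iG _.
- apply: aeW => x _; apply: cvg_near_cst; have [n0 h] := rs x.
  by exists n0 => // n /= n0n; rewrite /f_ h.
- apply: aeW => x n _; rewrite /f_ abse_EFin.
  apply: (@le_trans _ _ (\sum_(0 <= k < n) (g k x)%:E)%E).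
    by rewrite sumEFin lee_fin (le_trans (ler_norm_sum _ _ _))// ler_sum.
  by apply: nneseries_lim_ge => k _ _; rewrite lee_fin.
have fs : (\int[mu]_x (EFin \o s) x = (\int[mu]_x s x)%R%:E)%E.
  by rewrite fineK//; exact: integrable_fin_num ints.
rewrite fs in cv; move/fine_cvg : cv; apply: cvg_trans; apply: near_eq_cvg.
apply: nearW => n; rewrite /series/= /f_.
under eq_integral do rewrite -sumEFin.
rewrite integral_sum//=.
rewrite (eq_bigr (fun k => ((\int[mu]_x r k x)%R)%:E)) ?sumEFin// => k _.
by rewrite fineK//; exact: integrable_fin_num (ir k).
Qed.

Lemma csum_cintegral (F : nat -> T -> C) (S : T -> C) :
  (forall k, cmeasurable (F k)) ->
  (\sum_(k <oo) \int[mu]_x (l1norm (F k x))%:E < +oo)%E ->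
  (forall x, exists n0, forall n, (n0 <= n)%N -> \sum_(0 <= k < n) F k x = S x) ->
  csummable (fun k => cintegral mu setT (F k)) /\
  csum (fun k => cintegral mu setT (F k)) = cintegral mu setT S.
Proof.
move=> mF iF FS.
have mS : cmeasurable S.
  apply: (cmeasurable_near_eq (F := fun n x => \sum_(0 <= k < n) F k x)) => //.
  by move=> n; exact: cmeasurable_sum.
apply: csum_complex => /=.
  apply: (@cvg_series_Rintegral (fun k x => complex.Re (F k x)) _
    (fun k x => l1norm (F k x))) => //.
  - by move=> k; have [] := mF k.
  - by have [] := mS.
  - by move=> k; exact: measurable_l1norm.
  - by move=> k x; exact: Re_le_l1norm.
  - by move=> x; have [n0 h] := FS x; exists n0 => n nn; rewrite -(h n)// Re_sum.
apply: (@cvg_series_Rintegral (fun k x => complex.Im (F k x)) _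
  (fun k x => l1norm (F k x))) => //.
- by move=> k; have [] := mF k.
- by have [] := mS.
- by move=> k; exact: measurable_l1norm.
- by move=> k x; exact: Im_le_l1norm.
- by move=> x; have [n0 h] := FS x; exists n0 => n nn; rewrite -(h n)// Im_sum.
Qed.

End cintegral_series.

(** * One backward difference of a tensor product *)

Section tensor.
Context {R : realType}.
Local Notation C := (complex R).
Local Notation mR := (measurableTypeR R).
Local Notation mu := (@lebesgue_measure R).
Context (n : nat) (N : nat).
Local Notation nu := (lebesgue_tuple n).
Implicit Types (b : 'I_n -> R -> C) (Psi : n.-tuple mR -> C).

(** The bound is asked only on the orthant, where tame factors live. Nonnegative shifts map the
    orthant into itself and lower the weights, so the class is stable under them. *)
Definition dominated Psi : Prop :=
  cmeasurable Psi /\ exists2 K : R, 0 <= K & forall t : n.-tuple mR,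
    (forall i, 0 <= tnth t i :> R) ->
    l1norm (Psi t) <= K * \prod_(i < n) weight N (tnth t i).

Lemma dominated_tshift (v : 'I_n -> R) Psi : (forall i, 0 <= v i) ->
  dominated Psi -> dominated (Psi \o tshift v).
Proof.
move=> v0 [mPsi [K K0 PsiK]]; split.
  exact: (cmeasurable_comp mPsi (measurable_tshift v)).
exists K => // t t0; apply: (le_trans (PsiK _ _)) => [i|].
  by rewrite tnth_tshift addr_ge0.
apply: ler_wpM2l => //; apply: ler_prod => i _.
by rewrite weight_ge0 tnth_tshift weight_le ?lerDl.
Qed.

Definition tensor b Psi (t : n.-tuple mR) : C := (\prod_i b i (tnth t i)) * Psi t.

Lemma cmeasurable_tensor b Psi : (forall i, cmeasurable (b i)) ->
  cmeasurable Psi -> cmeasurable (tensor b Psi).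
Proof.
move=> mb mPsi; apply: cmeasurableM => //; apply: cmeasurable_prod => i.
exact: (cmeasurable_comp (mb i) (@measurable_tnth _ mR n i)).
Qed.

Lemma tensor_eq0 b Psi (t : n.-tuple mR) : (forall i, tame N (b i)) ->
  ~ orthant t -> tensor b Psi t = 0.
Proof.
move=> tb /existsNP[i /negP]; rewrite -ltNge => ti.
rewrite /tensor (bigD1 i)//=; have [_ bi0 _] := tb i.
by rewrite bi0 ?ltW// !mul0r.
Qed.

(** Passing to the whole space makes translation invariance available; the orthant itself is not
    invariant. *)
Lemma cintegral_orthant b Psi : (forall i, tame N (b i)) ->
  cintegral nu (@orthant R n) (tensor b Psi) = cintegral nu setT (tensor b Psi).
Proof.
move=> tb; rewrite /cintegral.
by congr Complex; rewrite Rintegral_mkcond; congr Rintegral; apply/funext => t;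
  rewrite patchE; case: ifPn => // /negP; rewrite inE => /(tensor_eq0 Psi tb) ->.
Qed.

Definition tame_mass b : \bar R :=
  (\prod_(i < n) \int[mu]_x (l1norm (b i x) * weight N x)%:E)%E.

Lemma tame_mass_ge0 b : (0 <= tame_mass b)%E.
Proof.
apply: prode_ge0 => i _; apply: integral_ge0 => x _; rewrite lee_fin.
exact: tame_ge0.
Qed.

Lemma tame_mass_fin_num b : (forall i, tame N (b i)) -> tame_mass b \is a fin_num.
Proof.
move=> tb; apply: prode_fin_num => i _; have [_ _ bN] := tb i.
by rewrite ge0_fin_numE// integral_ge0// => x _; rewrite lee_fin tame_ge0.
Qed.

Lemma le_tame_mass b b' :
  (forall i, (\int[mu]_x (l1norm (b i x) * weight N x)%:E <=
              \int[mu]_x (l1norm (b' i x) * weight N x)%:E)%E) ->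
  (tame_mass b <= tame_mass b')%E.
Proof.
(* Nonnegativity is carried along so that the inequalities can be multiplied. *)
move=> bb'; suff /andP[] : (0 <= tame_mass b <= tame_mass b')%E by [].
rewrite /tame_mass; elim/big_ind2 : _ => [|x1 x2 y1 y2|i _].
- by rewrite lexx lee01.
- move=> /andP[x10 x12] /andP[y10 y12].
  by rewrite mule_ge0//= lee_pmul.
- by rewrite bb' andbT integral_ge0// => x _; rewrite lee_fin tame_ge0.
Qed.

(** The weights bounding [Psi] are handed out to the coordinates, and Tonelli factors the integral.
    [K] is explicit because one constant must serve all terms of a series. *)
Lemma le_integral_tensor b Psi : (forall i, tame N (b i)) -> cmeasurable Psi ->
  forall K : R, 0 <= K -> (forall t : n.-tuple mR, (forall i, 0 <= tnth t i :> R) ->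
    l1norm (Psi t) <= K * \prod_(i < n) weight N (tnth t i)) ->
  (\int[nu]_t (l1norm (tensor b Psi t))%:E <= K%:E * tame_mass b)%E.
Proof.
move=> tb mPsi K K0 PsiK.
have mh i : measurable_fun [set: R] (fun x => l1norm (b i x) * weight N x).
  by apply/measurable_EFinP; exact: measurable_tame.
have h0 i x : 0 <= l1norm (b i x) * weight N x by exact: tame_ge0.
rewrite /tame_mass -(integral_tuple_prod mh h0).
have mp : measurable_fun [set: n.-tuple mR]
    (fun t => (\prod_(i < n) (l1norm (b i (tnth t i)) * weight N (tnth t i)))%:E).
  apply/measurable_EFinP/measurable_prod => i _.
  exact: (measurableT_comp (mh i) (@measurable_tnth _ mR n i)).
rewrite -ge0_integralZl//; last first.
  by move=> t _; rewrite lee_fin prodr_ge0.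
apply: ge0_le_integral => //.
- by move=> t _; rewrite lee_fin l1norm_ge0.
- apply/measurable_EFinP/measurable_l1norm/cmeasurable_tensor => //.
  by move=> i; have [] := tb i.
- exact: measurable_funeM.
move=> t _; rewrite -EFinM lee_fin.
have [t0|/(tensor_eq0 Psi tb) ->] := pselect (orthant t); last first.
  by rewrite l1norm0 mulr_ge0// prodr_ge0.
rewrite (le_trans (l1normM _ _))// big_split/= mulrCA.
by rewrite ler_pM ?l1norm_ge0 ?l1norm_prod ?PsiK.
Qed.

Lemma cintegrable_tensor b Psi : (forall i, tame N (b i)) -> dominated Psi ->
  cintegrable nu (tensor b Psi).
Proof.
move=> tb [mPsi [K K0 PsiK]]; split.
  by apply: cmeasurable_tensor => // i; have [] := tb i.
apply: le_lt_trans (le_integral_tensor tb mPsi K0 PsiK) _.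
by rewrite -(fineK (tame_mass_fin_num tb)) -EFinM ltry.
Qed.

Definition upd b (j : 'I_n) (f : R -> C) (i : 'I_n) := if i == j then f else b i.

Lemma tensor_upd b j f Psi (t : n.-tuple mR) :
  tensor (upd b j f) Psi t =
  f (tnth t j) * ((\prod_(i < n | i != j) b i (tnth t i)) * Psi t).
Proof.
rewrite /tensor (bigD1 j)//= /upd eqxx mulrA; congr (_ * _ * _).
by apply: eq_bigr => i /negbTE ->.
Qed.

Lemma tame_shift (b0 : R -> C) (k : nat) : tame N b0 -> tame N (fun t => b0 (t - k%:R)).
Proof.
move=> tb; have [mb b00 bN] := tb; split; first exact: cmeasurable_shift.
  by move=> t t0; rewrite b00// subr_le0 (le_trans t0).
exact: le_lt_trans (integral_tame_shift k tb) bN.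
Qed.

Definition single (j : 'I_n) (x : R) (i : 'I_n) : R := if i == j then x else 0.

Lemma cintegral_tshift (v : 'I_n -> R) Psi : cmeasurable Psi ->
  cintegral nu setT (Psi \o tshift v) = cintegral nu setT Psi.
Proof.
move=> [mR_ mI]; rewrite /cintegral /Rintegral; congr (Complex (fine _) (fine _)).
  by rewrite -[RHS](integral_tshift v)//; exact/measurable_EFinP.
by rewrite -[RHS](integral_tshift v)//; exact/measurable_EFinP.
Qed.

(** Translation invariance leaves [Psi] fixed and shifts the factor j instead, so all terms share
    the bound on [Psi]. *)
Lemma csum_tensor b j (c : nat -> C) (Kc : R) Psi :
  (forall i, tame N (b i)) -> dominated Psi ->
  (forall m, \sum_(0 <= k < m) l1norm (c k) <= Kc) ->
  let u k := c k * cintegral nu setT (tensor b (Psi \o tshift (single j k%:R))) in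
  csummable u /\
  csum u = cintegral nu setT (tensor (upd b j (shift_sum c (b j))) Psi).
Proof.
move=> tb dPsi cK u; have [mPsi [K K0 PsiK]] := dPsi.
pose bk k := upd b j (fun t => b j (t - k%:R)).
have tbk k i : tame N (bk k i).
  by rewrite /bk /upd; case: ifP => // _; exact: tame_shift.
pose F k t := c k * tensor (bk k) Psi t.
have uE : u = fun k => cintegral nu setT (F k).
  apply/funext => k; rewrite /u [RHS]cintegralZl; last exact: cintegrable_tensor.
  congr (_ * _); rewrite -[RHS](cintegral_tshift (single j k%:R)); last first.
    by apply: cmeasurable_tensor => // i; have [] := tbk k i.
  congr (cintegral nu setT); apply/funext => t /=.
  rewrite /tensor; congr (_ * _); apply: eq_bigr => i _.
  rewrite tnth_tshift /bk /upd /single; case: eqP => [->|_].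
    by rewrite addrK.
  by rewrite addr0.
rewrite uE; apply: csum_cintegral.
- move=> k; apply: cmeasurableM; first exact: cmeasurable_cst.
  by apply: cmeasurable_tensor => // i; have [] := tbk k i.
(* Term k has mass at most |c_k| K [tame_mass b], since shifting the factor j does not increase its
   weighted integral. *)
- apply: (@le_lt_trans _ _ (Kc%:E * (K%:E * tame_mass b))%E); last first.
    by rewrite -(fineK (tame_mass_fin_num tb)) -!EFinM ltry.
  have Kb0 : (0 <= K%:E * tame_mass b)%E by rewrite mule_ge0// tame_mass_ge0.
  apply: lime_le.
    apply: is_cvg_nneseries => k _ _; apply: integral_ge0 => t _.
    by rewrite lee_fin l1norm_ge0.
  apply: nearW => m.
  apply: (@le_trans _ _ (\sum_(0 <= k < m) (l1norm (c k))%:E * (K%:E * tame_mass b))%E).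
    apply: lee_sum => k _.
    apply: (@le_trans _ _
      ((l1norm (c k))%:E * \int[nu]_t (l1norm (tensor (bk k) Psi t))%:E)%E).
      have mt : measurable_fun [set: n.-tuple mR] (fun t => l1norm (tensor (bk k) Psi t)).
        apply: measurable_l1norm; apply: cmeasurable_tensor => // i.
        by have [] := tbk k i.
      rewrite -ge0_integralZl//; last 3 first.
      + exact/measurable_EFinP.
      + by move=> t _; rewrite lee_fin l1norm_ge0.
      + by rewrite lee_fin l1norm_ge0.
      apply: ge0_le_integral => //.
      + by move=> t _; rewrite lee_fin l1norm_ge0.
      + apply/measurable_EFinP/measurable_l1norm; apply: cmeasurableM.
          exact: cmeasurable_cst.
        by apply: cmeasurable_tensor => // i; have [] := tbk k i.
      + by apply: measurable_funeM; exact/measurable_EFinP.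
      + by move=> t _; rewrite -EFinM lee_fin l1normM.
    rewrite lee_wpmul2l ?lee_fin ?l1norm_ge0//.
    apply: le_trans (le_integral_tensor (tbk k) mPsi K0 PsiK) _.
    rewrite lee_wpmul2l ?lee_fin//.
    apply: le_tame_mass => i; rewrite /bk /upd; case: eqP => [->|_]//.
    exact: integral_tame_shift.
  rewrite -ge0_sume_distrl; last by move=> k _; rewrite lee_fin l1norm_ge0.
  by rewrite sumEFin lee_wpmul2r// lee_fin.
- move=> t; exists (Num.truncn (tnth t j)).+1 => m tm.
  have tm' : tnth t j <= m%:R :> R.
    by rewrite (le_trans (ltW (truncnS_gt _)))// ler_nat.
  rewrite tensor_upd (shift_sum_finite c (tb j) tm').2 mulr_suml.
  by apply: eq_bigr => k _; rewrite /F tensor_upd mulrA.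
Qed.

End tensor.

(** * Decay of Schwartz functions on the cone *)

Section cone.
Context {R : realType}.

Lemma finite_lower_bound n (f : 'I_n -> R) : (forall j, 0 < f j) ->
  exists2 c, 0 < c & forall j, c <= f j.
Proof.
move=> f0; have s0 : 0 < \sum_j (f j)^-1 + 1.
  by rewrite ltr_wpDl// sumr_ge0// => j _; rewrite invr_ge0 ltW.
(* The added 1 makes the reciprocal meaningful for the empty family as well. *)
exists (\sum_j (f j)^-1 + 1)^-1; first by rewrite invr_gt0.
move=> j; rewrite invf_ple ?posrE// (bigD1 j)//= -addrA lerDl addr_ge0//.
by rewrite sumr_ge0// => i _; rewrite invr_ge0 ltW.
Qed.

(* Lexicographic positivity of the columns makes the cone [M t], [t >= 0],
   pointed: the functional with coefficients [e ^+ i], [e] small, is positive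
   on every column. *)
Lemma positive_functional d n (M : 'M[R]_(d, n)) : first_nonzero_pos M ->
  exists l : 'I_d -> R, exists2 c, 0 < c &
    forall j, c <= \sum_i l i * M i j.
Proof.
move=> HM; have [f fP] := choice HM.
have [e0 e00 e0P] := @finite_lower_bound n (fun j => M (f j) j) (fun j => (fP j).2).
pose B := \sum_j \sum_i `|M i j|.
have B0 : 0 <= B by rewrite sumr_ge0// => j _; rewrite sumr_ge0.
(* [e <= 1] makes the powers of [e] nonincreasing; [e * B < e0] makes the entries below the leading
   one too small, in total, to cancel it. *)
pose e := Num.min 1 (e0 / (B + 1)).
have eP : 0 < e by rewrite lt_min ltr01 divr_gt0// ltr_wpDl.
have e1 : e <= 1 by rewrite ge_min lexx.
have eB : e * B < e0.
  have : e <= e0 / (B + 1) by rewrite ge_min lexx orbT.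
  rewrite ler_pdivlMr ?ltr_wpDl// mulrDr mulr1; lra.
exists (fun i => e ^+ i).
apply: finite_lower_bound => j; have [Hlt Hpos] := fP j.
rewrite (bigD1 (f j))//=.
have : \sum_(i < d | i != f j) e ^+ i * M i j >= - (e ^+ (f j) * (e * B)).
  apply: (@le_trans _ _ (\sum_(i < d | i != f j) - (e ^+ f j * (e * `|M i j|)))).
    rewrite sumrN lerN2 -!mulr_sumr ler_wpM2l ?exprn_ge0 ?ler_wpM2l ?(ltW eP)//.
    apply: (@le_trans _ _ (\sum_i `|M i j|)).
      by rewrite [leRHS](bigD1 (f j))//= lerDr.
    by rewrite /B [leRHS](bigD1 j)//= lerDl sumr_ge0// => k _; rewrite sumr_ge0.
  apply: ler_sum => i ifj; have [ij|fi] := ltnP i (f j).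
    by rewrite Hlt// normr0 !mulr0 oppr0.
  have efi : e ^+ i <= e ^+ f j * e.
    rewrite -exprSr ler_wiXn2l ?(ltW eP)//.
    by rewrite ltn_neqAle fi andbT eq_sym.
  rewrite lerNl -mulrN mulrA (le_trans (ler_wpM2l (exprn_ge0 _ (ltW eP)) (ler_norm _)))//.
  by rewrite normrN ler_wpM2r.
have := e0P j; have : 0 < e ^+ f j by rewrite exprn_gt0.
nra.
Qed.

End cone.

Section decay.
Context {R : realType} (d : nat).
Local Notation C := (complex R).

(** Schwartz bounds come with monomials, so powers of the affine form are expanded one factor at a
    time. Each factor may raise an exponent, hence the induction holds for all [a]. *)
Lemma schwartz_real_functional (f : 'cV[R]_d -> R) (l : 'I_d -> R) (p : nat) :
  schwartz_real f -> forall a : 'I_d -> nat, exists K : R, forall x : 'cV[R]_d,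
    `|(1 + \sum_i l i * x i ord0) ^+ p * (\prod_i x i ord0 ^+ a i) * f x| <= K.
Proof.
move=> [_ Sf]; elim: p => [|p IHp] a.
  have [K HK] := Sf a [::]; exists K => x; rewrite expr0 mul1r; exact: HK.
pose a' i (k : 'I_d) := (a k + (k == i))%N.
have [K0 HK0] := IHp a.
have [Ki HKi] := choice (fun i => IHp (a' i)).
exists (K0 + \sum_i `|l i| * Ki i) => x.
pose m := \prod_i x i ord0 ^+ a i.
have mE i : x i ord0 * m = \prod_k x k ord0 ^+ a' i k.
  rewrite /m /a' [in RHS](bigD1 i)//= [in LHS](bigD1 i)//= eqxx addn1 exprS mulrA.
  by congr (_ * _); apply: eq_bigr => k /negbTE ->; rewrite addn0.
set q := 1 + \sum_i _.
have -> : q ^+ p.+1 * m * f x =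
    q ^+ p * m * f x + \sum_i l i * (q ^+ p * (x i ord0 * m) * f x).
  rewrite exprSr {2}/q mulrDr mulr1 !mulrDl; congr (_ + _).
  rewrite mulr_sumr !mulr_suml; apply: eq_bigr => i _; ring.
rewrite (le_trans (ler_normD _ _))// lerD//; first exact: HK0.
rewrite (le_trans (ler_norm_sum _ _ _))//; apply: ler_sum => i _.
by rewrite normrM ler_wpM2l// mE; exact: HKi.
Qed.

Lemma mxapp_functional n (M : 'M[R]_(d, n)) (l : 'I_d -> R) (t : n.-tuple R) :
  \sum_i l i * mxapp M t i ord0 = \sum_j tnth t j * \sum_i l i * M i j.
Proof.
under eq_bigr do rewrite !mxE mulr_sumr.
rewrite exchange_big/=; apply: eq_bigr => j _; rewrite mulr_sumr.
by apply: eq_bigr => i _; rewrite !mxE; ring.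
Qed.

(** On the cone the affine form [q] controls every 1 + t_j up to a constant, so the product of the
    (1 + t_j)^N is at most a multiple of q^(N n), which Schwartz decay absorbs. *)
Lemma schwartz_real_cone n (M : 'M[R]_(d, n)) (f : 'cV[R]_d -> R) N :
  first_nonzero_pos M -> schwartz_real f ->
  exists2 K : R, 0 <= K & forall t : n.-tuple R, (forall i, 0 <= tnth t i) ->
    `|f (mxapp M t)| <= K * \prod_(i < n) weight N (tnth t i).
Proof.
move=> /positive_functional[l [c c0 lc]] Sf.
have [K HK] := schwartz_real_functional l (N * n) Sf (fun=> 0%N).
have K0 : 0 <= K by exact: le_trans (HK 0).
(* From c t_j <= q - 1 and q >= 1 follows 1 + t_j <= 1 + (q - 1) / c <= (1 + 1/c) q. *)
pose D := 1 + c^-1.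
have D0 : 0 < D by rewrite ltr_pwDl// invr_ge0 ltW.
exists (K * D ^+ (N * n)); first by rewrite mulr_ge0// exprn_ge0// ltW.
move=> t t0.
set q := 1 + \sum_i l i * mxapp M t i ord0.
have qE : q - 1 = \sum_j tnth t j * \sum_i l i * M i j.
  by rewrite /q mxapp_functional addrAC subrr add0r.
have term0 j : 0 <= tnth t j * \sum_i l i * M i j.
  by rewrite mulr_ge0// (le_trans (ltW c0)).
have q1 : 1 <= q by rewrite -subr_ge0 qE sumr_ge0.
have qt j : 1 + tnth t j <= D * q.
  have h : c * tnth t j <= q - 1.
    rewrite qE (bigD1 j)//= [c * _]mulrC.
    by rewrite ler_wpDr ?ler_wpM2l// sumr_ge0.
  have : tnth t j <= c^-1 * (q - 1) by rewrite ler_pdivlMl.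
  have : 0 < c^-1 by rewrite invr_gt0.
  rewrite /D; nra.
have q0 : 0 <= q by exact: le_trans q1.
have Pw : (\prod_(i < n) weight N (tnth t i))^-1 <= (D * q) ^+ (N * n).
  rewrite -prodfV exprM -[X in _ ^+ X]card_ord -prodr_const.
  apply: ler_prod => i _; rewrite invr_ge0 weight_ge0/= /weight exprVn invrK.
  by rewrite lerXn2r ?nnegrE ?addr_ge0 ?mulr_ge0 ?(ltW D0)// ger0_norm.
have Pw0 : 0 < \prod_(i < n) weight N (tnth t i).
  by apply: prodr_gt0 => i _; rewrite exprn_gt0// invr_gt0 ltr_wpDr.
have := HK (mxapp M t).
rewrite -/q big1 ?mulr1 => [|i _]; last by rewrite expr0.
rewrite normrM ger0_norm ?exprn_ge0// => HKt.
rewrite -ler_pdivrMr// (le_trans (ler_wpM2l (normr_ge0 _) Pw))//.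
by rewrite exprMn mulrCA mulrC ler_wpM2r ?exprn_ge0 ?(ltW D0)// mulrC.
Qed.

End decay.

(** * Continuous functions of measurable coordinates *)

Section measurable_continuous.
Context {R : realType} d (T : measurableType d).

Lemma measurable_countable_comp (I : countType) (h : T -> I) (F : I -> R) :
  (forall v, measurable (h @^-1` [set v])) -> measurable_fun [set: T] (F \o h).
Proof.
move=> mh _ B mB; rewrite setTI.
rewrite (_ : _ @^-1` B = \bigcup_k
   (if unpickle k is Some v then
      (if F v \in B then h @^-1` [set v] else set0) else set0)).
  apply: bigcup_measurable => k _; case: (unpickle k) => // v.
  by case: ifP.
apply/seteqP; split => [t /= Bt|t [k _]] /=.
  by exists (pickle (h t)) => //; rewrite pickleK mem_set.
by case: (unpickle k) => // v; case: ifP => // /set_mem Bv /= ->.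
Qed.

(** Rounding [g] down to the grid of step 1 / (k + 1) gives countably many values on measurable
    sets; by continuity of [f] the rounded compositions converge pointwise. *)
Lemma measurable_continuous_cV m (g : T -> 'cV[R]_m) (f : 'cV[R]_m -> R) :
  (forall i, measurable_fun [set: T] (fun t => g t i ord0)) -> continuous f ->
  measurable_fun [set: T] (fun t => f (g t)).
Proof.
move=> mg cf.
pose h k t : {ffun 'I_m -> int} := [ffun i => Num.floor (k.+1%:R * g t i ord0)].
pose q k (v : {ffun 'I_m -> int}) : 'cV[R]_m := \col_i (k.+1%:R^-1 * (v i)%:~R).
apply: (@measurable_fun_cvg _ _ _ _ (fun k => (f \o q k) \o h k)).
  move=> k; apply: measurable_countable_comp => v.
  rewrite (_ : _ @^-1` _ = \bigcap_(i in [set: 'I_m])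
     ((fun t => k.+1%:R * g t i ord0) @^-1` `[(v i)%:~R, (v i + 1)%:~R[)).
    apply: fin_bigcap_measurable => // i _; rewrite -[X in measurable X]setTI.
    have : measurable_fun [set: T] (fun t => k.+1%:R * g t i ord0).
      by apply: measurable_funM => //; exact: measurable_cst.
    by apply => //; exact: measurable_itv.
  apply/seteqP; split => t /=.
    move=> <- i _ /=; rewrite in_itv/= ffunE.
    by rewrite ge_floor floorD1_gt.
  move=> H; apply/ffunP => i; rewrite ffunE; apply: floor_def.
  by have := H i I; rewrite /= in_itv/=.
move=> t _; apply: (continuous_cvg _ (cf (g t))).
apply/cvg_ballP => e e0; near=> k.
have ke : k.+1%:R^-1 < e :> R.
  by near: k; exact: (near_infty_natSinv_lt (PosNum e0)).
split => // i j; rewrite !mxE ffunE ord1 -ball_normE /ball_/=.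
have /andP[h1 h2] := floor_itv (k.+1%:R * g t i ord0).
have k0 : 0 < k.+1%:R^-1 :> R by rewrite invr_gt0.
have kn0 : k.+1%:R != 0 :> R by [].
rewrite -[X in X - _](mulKf kn0) -mulrBr.
rewrite intrD in h2; rewrite ger0_norm; last by rewrite mulr_ge0 ?(ltW k0)// subr_ge0.
by rewrite (le_lt_trans _ ke)// ger_pMr// lerBlDl ltW.
Unshelve. all: by end_near. Qed.

End measurable_continuous.

(** * Complex box splines *)

Section box_spline_difference.
Context {R : realType} (d n : nat) (M : 'M[R]_(d, n)) (z : 'I_n -> complex R).
Context (N : nat).
Local Notation C := (complex R).
Local Notation mR := (measurableTypeR R).
Local Notation pullback psi := (fun t : n.-tuple mR => psi (mxapp M t)).
Hypothesis z_gt : forall j, -1 < complex.Re (z j).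
Hypothesis z_le : forall j, complex.Re (z j) <= N%:R.

Lemma mxapp_tshift (j : 'I_n) (x : R) (t : n.-tuple mR) :
  mxapp M (tshift (single j x) t) = mxapp M t + x *: col j M.
Proof.
apply/matrixP => i k; rewrite !mxE (bigD1 j)//= [in RHS](bigD1 j)//=.
rewrite !mxE tnth_tshift /single eqxx mulrDr [M i j * x]mulrC addrAC.
congr (_ + _ + _); apply: eq_bigr => l /negbTE lj.
by rewrite !mxE tnth_tshift lj addr0.
Qed.

Lemma dominated_schwartz (phi : 'cV[R]_d -> C) : first_nonzero_pos M ->
  schwartz phi -> dominated N (pullback phi).
Proof.
move=> HM [SR SI]; split.
  have mg i : measurable_fun [set: n.-tuple mR] (fun t => mxapp M t i ord0).
    under eq_fun do rewrite mxE.
    apply: measurable_sum => j; apply: measurable_funM; first exact: measurable_cst.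
    under eq_fun do rewrite mxE.
    exact: measurable_tnth.
  split.
    apply: (measurable_continuous_cV (f := fun x => complex.Re (phi x)) mg).
    by have [/(_ [::])[]] := SR.
  apply: (measurable_continuous_cV (f := fun x => complex.Im (phi x)) mg).
  by have [/(_ [::])[]] := SI.
have [K1 K10 H1] := schwartz_real_cone N HM SR.
have [K2 K20 H2] := schwartz_real_cone N HM SI.
exists (K1 + K2); first exact: addr_ge0.
by move=> t t0; rewrite mulrDl lerD ?H1 ?H2.
Qed.

Definition factor (s : seq 'I_n) (i : 'I_n) : R -> C :=
  if i \in s then bspline (z i) else cpower (z i).

Lemma bsplineE (w : C) :
  bspline w = shift_sum (fun k => (-1) ^+ k * gbinom (w + 1) k) (cpower w).
Proof. by []. Qed.

Lemma l1norm_sign (k : nat) (w : C) : l1norm ((-1) ^+ k * w) = l1norm w.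
Proof.
rewrite -signr_odd; case: odd; rewrite ?expr0 ?expr1 ?mul1r//.
by rewrite mulN1r /l1norm ReN ImN !normrN.
Qed.

Lemma bdiff_coef_summable (w : C) : -1 < complex.Re w ->
  exists K : R, forall m,
    \sum_(0 <= k < m) l1norm ((-1) ^+ k * gbinom (w + 1) k) <= K.
Proof.
move=> w1; have [|K HK] := @gbinom_summable R (w + 1).
  by rewrite ReD /=; lra.
by exists K => m; under eq_bigr do rewrite l1norm_sign.
Qed.

Lemma tame_factor s i : tame N.+2 (factor s i).
Proof.
have tc := cpower_tame (z_gt i) (z_le i).
rewrite /factor; case: ifP => // _; rewrite bsplineE.
have [K HK] := bdiff_coef_summable (z_gt i).
exact: tame_shift_sum HK tc.
Qed.

Definition mixed_spline s (psi : 'cV[R]_d -> C) : C :=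
  cintegral (lebesgue_tuple n) setT (tensor (factor s) (pullback psi)).

(** [T] is known only on dominated test functions, which is enough because the translates by k m_j
    stay dominated. It can thus be the result of earlier differences. *)
Lemma bdiff_mixed_spline s j psi (T : ('cV[R]_d -> C) -> C) : j \notin s ->
  (forall psi, dominated N.+2 (pullback psi) -> T psi = mixed_spline s psi) ->
  dominated N.+2 (pullback psi) ->
  csummable (bdiff_term (z j + 1) (col j M) T psi) /\
  bdiff (z j + 1) (col j M) T psi = mixed_spline (j :: s) psi.
Proof.
move=> js TE dpsi.
have [K HK] := bdiff_coef_summable (z_gt j).
pose u k := (-1) ^+ k * gbinom (z j + 1) k * cintegral (lebesgue_tuple n) setT
  (tensor (factor s) (pullback psi \o tshift (single j k%:R))).
have [su cu] : csummable u /\ csum u = _ := csum_tensor j (tame_factor s) dpsi HK.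
have uE : u = bdiff_term (z j + 1) (col j M) T psi.
  apply/funext => k; rewrite /u /bdiff_term /transl; congr (_ * _).
  have shiftE : pullback psi \o tshift (single j k%:R) =
      (fun t => psi (mxapp M t + k%:R *: col j M)).
    by apply/funext => t /=; rewrite mxapp_tshift.
  rewrite shiftE TE// -shiftE; apply: dominated_tshift => // i.
  by rewrite /single; case: ifP.
rewrite /bdiff -uE cu; split => //; rewrite /mixed_spline.
congr (cintegral _ _ (tensor _ _)); apply/funext => i.
rewrite /upd /factor inE; case: eqP => [->|]//=.
by rewrite (negbTE js) bsplineE.
Qed.

(** The head of the list is the outermost operator and evaluates the rest at translated functions,
    so the induction hypothesis ranges over all dominated ones. [uniq] ensures that no factor is
    replaced twice. *)
Lemma bdiff_seq_mixed_spline s psi : uniq s -> dominated N.+2 (pullback psi) ->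
  (\big[comp/idfun]_(j <- s) bdiff (z j + 1) (col j M)) (trunc_power z M) psi =
  mixed_spline s psi.
Proof.
elim: s psi => [|j s IHs] psi.
  move=> _ _; rewrite big_nil /= /trunc_power /mixed_spline.
  rewrite -(cintegral_orthant _ (tame_factor [::])).
  by [].
move=> /= /andP[js us] dpsi; rewrite big_cons /=.
by apply: (bdiff_mixed_spline js _ dpsi).2 => chi dchi; exact: IHs.
Qed.

Lemma bdiff_prodE (P : pred 'I_n) psi : dominated N.+2 (pullback psi) ->
  bdiff_prod z M P (trunc_power z M) psi =
  mixed_spline [seq j <- index_enum 'I_n | P j] psi.
Proof.
move=> dpsi; rewrite /bdiff_prod -big_filter bdiff_seq_mixed_spline//.
by rewrite filter_uniq// index_enum_uniq.
Qed.

Lemma box_splineE psi : dominated N.+2 (pullback psi) ->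
  box_spline z M psi = mixed_spline (index_enum 'I_n) psi.
Proof.
move=> dpsi; rewrite /mixed_spline -(cintegral_orthant _ (tame_factor _)).
rewrite /box_spline /tensor; congr (cintegral _ _ _); apply/funext => t.
by congr (_ * _); apply: eq_bigr => j _; rewrite /factor mem_index_enum.
Qed.

End box_spline_difference.

Theorem theorem4p5 (R : realType) (d n : nat) (M : 'M[R]_(d, n.+1))
    (z : 'I_n.+1 -> complex R) :
  direction_set M -> first_nonzero_pos M ->
  (forall j, -1 < complex.Re (z j)) ->
  (forall j : 'I_n.+1, bdiff_cvg (z j + 1) (col j M)
     (bdiff_prod z M (fun i : 'I_n.+1 => (j < i)%N) (trunc_power z M))) /\
  (forall phi : 'cV[R]_d -> complex R, schwartz phi ->
     box_spline z M phi = bdiff_prod z M predT (trunc_power z M) phi).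
Proof.
move=> _ HM z_gt.
(* One exponent above every Re z_j, so that all factors are tame for the same weight. *)
pose N := \max_(j < n.+1) (Num.truncn (complex.Re (z j))).+1.
have z_le j : complex.Re (z j) <= N%:R.
  rewrite (le_trans (ltW (truncnS_gt _)))// ler_nat.
  exact: (leq_bigmax (F := fun j => (Num.truncn (complex.Re (z j))).+1)).
split=> [j phi Sphi|phi Sphi].
  (* The inner differences have replaced the factors of index above j; since j is not among these,
     the next series converges. *)
  have [|||//] := @bdiff_mixed_spline _ _ _ M _ _ z_gt z_le
    [seq i : 'I_n.+1 <- index_enum 'I_n.+1 | (j < i)%N] j phi
    (bdiff_prod z M (fun i : 'I_n.+1 => (j < i)%N) (trunc_power z M)).
  - by rewrite mem_filter ltnn.
  - by move=> psi dpsi; exact: bdiff_prodE.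
  - exact: dominated_schwartz.
have dphi := dominated_schwartz N.+2 HM Sphi.
rewrite (box_splineE z_gt z_le dphi) (bdiff_prodE z_gt z_le _ dphi).
by rewrite filter_predT.
Qed.
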